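(* Let $d\in\mathbb N$ and let $\varrho\colon\mathfrak{sl}_d\to L(\mathcal H(\mathbb C^d))$ be the representation on the space $\mathcal H(\mathbb C^d)$ of entire holomorphic functions on $\mathbb C^d$ given on matrix units by $$(E_{nm}\triangleright f)(z)=z^n\cdot(\partial_mf)(z)\qquad(1\le n,m\le d),$$ extended linearly. Then $$\mathcal E_0(\varrho)=\mathcal H(\mathbb C^d)$$ as locally convex spaces.
   Context: $z=(z^1,\dots,z^d)$ are the standard coordinates of $\mathbb C^d$ and $\partial_m$ is the holomorphic partial derivative in direction $z^m$. $E_{nm}$ are the matrix units of $\mathrm{Mat}_d(\mathbb C)$; $\mathfrak{sl}_d\subseteq\mathrm{Mat}_d(\mathbb C)$ (traceless matrices, viewed as a real Lie algebra) carries the Frobenius norm, and $\mathbb B$ denotes its open unit ball. $\mathcal H(\mathbb C^d)$ carries the Fréchet topology of locally uniform convergence, e.g. defined by the norms $\|f\|_r=\max\{|f(z)|:|z^k|\le r\text{ for all }k\}$, $r>0$. $\mathrm{cs}(V)$ is the set of continuous seminorms and $L(V)$ the continuous linear endomorphisms of $V$. For a representation $\varrho$ on $V$, $R\ge0$, $q\in\mathrm{cs}(V)$, $r\ge0$: $p^{(R)}_{r,q}(v)=\sum_{n=0}^\infty n!^{R-1}r^n\sup_{\xi_1,\dots,\xi_n\in\mathbb B}q(\xi_1\cdots\xi_n\triangleright v)\in[0,\infty]$. The space of entire vectors of order $R$ is $\mathcal E_R(\varrho)=\{v\in V:p^{(R)}_{r,q}(v)<\infty\ \forall q\in\mathrm{cs}(V),r\ge0\}$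 with the topology of all seminorms $p^{(R)}_{r,q}$. *)

(* Defs.v *)
From HB Require Import structures.
From mathcomp Require Import all_boot all_order all_algebra.
From mathcomp Require Import all_classical all_reals all_analysis.
From mathcomp Require Import complex ring lra.

Set Implicit Arguments.
Unset Strict Implicit.
Unset Printing Implicit Defensive.
Set Warnings "-redundant-canonical-projection".

Import Order.TTheory GRing.Theory Num.Theory.
Import numFieldNormedType.Exports.

Local Open Scope classical_set_scope.
Local Open Scope ring_scope.

(* R[i] has no topology of its own in the libraries: copy the modulus metric
   that every numFieldType carries through its alias R[i]^o. *)
HB.instance Definition _ (R : realType) :=
  PseudoMetricNormedZmod.copy R[i] R[i]^o.
HB.instance Definition _ (R : realType) := NormedModule.copy R[i] R[i]^o.

Section Entire.
Context (R : realType) (d : nat).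
Local Notation C := R[i].
Local Notation Cd := 'rV[C]_d.

(* Scalars are complex, so [differentiable] is complex differentiability. *)
Definition holomorphic : {pred (Cd -> C)} :=
  fun f => `[< forall z : Cd, differentiable f z >].

Lemma holomorphicP (f : Cd -> C) :
  reflect (forall z : Cd, differentiable f z) (f \in holomorphic).
Proof. exact: asboolP. Qed.

Fact holomorphic_submod : submod_closed holomorphic.
Proof.
split; first by apply/holomorphicP => z; exact: (differentiable_cst (0 : C)).
move=> a f g /holomorphicP hf /holomorphicP hg; apply/holomorphicP => z.
by apply: differentiableD => //; apply: differentiableZ.
Qed.

HB.instance Definition _ := GRing.isSubmodClosed.Build C (Cd -> C) holomorphic
  holomorphic_submod.

Record entire := Entire { entire_fun :> Cd -> C ; _ : entire_fun \in holomorphic }.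

HB.instance Definition _ := [isSub for entire_fun].
HB.instance Definition _ := [Choice of entire by <:].
HB.instance Definition _ := [SubChoice_isSubLmodule of entire by <:].

(* Locally uniform convergence, i.e. uniform convergence on compact sets since
   C^d is locally compact. *)
HB.instance Definition _ := Uniform.copy entire
  (initial_topology (entire_fun : entire -> {family compact, Cd -> C})).

End Entire.
Arguments entire_fun {R d} _ _.

Section EntireTopology.
Context (R : realType) (d : nat).
Local Notation C := R[i].
Local Notation Cd := 'rV[C]_d.
Local Notation H := (entire R d).
Implicit Types (f g h : H) (K : set Cd) (e : R).

Let tube K e (f : Cd -> C) : set (Cd -> C) :=
  [set g | forall z, K z -> `|f z - g z| < e%:C%C].

Let gt0_realC (x : C) : 0 < x -> exists2 e : R, 0 < e & x = e%:C%C.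
Proof.
by case: x => a b; rewrite ltcE/= => /andP[/eqP b0 a0]; exists a => //; rewrite b0.
Qed.

Lemma entire_nbhsP f (A : set H) : nbhs f A <->
  exists K e, [/\ compact K, 0 < e & forall g, tube K e f g -> A g].
Proof.
split=> [[_ [[B oB <-] Bf]] sBA|[K [e [cK e0 sA]]]].
  pose G : set_system (Cd -> C) :=
    filter_from [set p : set Cd * R | compact p.1 /\ 0 < p.2]
                (fun p => tube p.1 p.2 f).
  have FG : Filter G.
    apply: filter_from_filter; first by exists (set0, 1); split; [exact: compact0|].
    move=> [K1 e1] [K2 e2] /= [c1 e10] [c2 e20].
    exists (K1 `|` K2, Num.min e1 e2) => /=.
      by split; [exact: compactU|rewrite lt_min e10].
    move=> g /= fg; split=> z Kz; (apply: lt_le_trans (fg z _) _;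
      [by [left|right]|by rewrite lecR ge_min lexx ?orbT]).
  have /(_ B) : {family compact, G --> (f : Cd -> C)}.
    apply/fam_cvgP => K cK P /uniform_nbhs [E [entE sEP]].
    move: entE; rewrite -entourage_ballE => -[x /= x0 sxE].
    have [e e0 xE] := gt0_realC x0.
    exists (K, e) => //= g fg; apply: sEP => z Kz; apply: sxE => /=.
    by rewrite -ball_normE /= xE; exact: fg.
  have nB : nbhs (entire_fun f : {family compact, Cd -> C}) B.
    exact: open_nbhs_nbhs.
  by move=> /(_ nB) [[K e] /= [cK e0] sB]; exists K, e; split => // g /sB /sBA.
have nT : nbhs (entire_fun f : {family compact, Cd -> C})
    [set g | forall y, K y -> [set p : C * C | ball p.1 e%:C%C p.2] (f y, g y)].
  apply: fam_nbhs => //; rewrite -entourage_ballE; exists e%:C%C => //=.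
  by rewrite ltcR.
have := @initial_continuous _ _ (entire_fun : H -> {family compact, Cd -> C}) f _ nT.
rewrite nbhs_simpl => nT'; apply: (@filterS _ (nbhs f) _ _ _ _ nT') => g /= fg.
by apply: sA => z /fg; rewrite -ball_normE.
Qed.

Let entire_addE f g z : (f + g) z = f z + g z. Proof. by []. Qed.
Let entire_scaleE (a : C) f z : (a *: f) z = a * f z. Proof. by []. Qed.

Fact entire_add_continuous : continuous (fun p : H * H => p.1 + p.2).
Proof.
move=> [f g] A /entire_nbhsP [K [e [cK e0 sA]]].
have e20 : 0 < e / 2 by rewrite divr_gt0.
exists (tube K (e / 2) f \o entire_fun, tube K (e / 2) g \o entire_fun).
  by split; apply/entire_nbhsP; exists K, (e / 2).
move=> [f' g'] /= [ff' gg']; apply: sA => z Kz.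
rewrite !entire_addE opprD addrACA (le_lt_trans (ler_normD _ _))//.
by rewrite [e]splitr rmorphD ltrD// ?ff' ?gg'.
Qed.

Let norm_realC (x : C) : exists2 e : R, 0 <= e & `|x| = e%:C%C.
Proof. by exists (Num.sqrt (complex.Re x ^+ 2 + complex.Im x ^+ 2)); rewrite ?sqrtr_ge0 ?normc_def. Qed.

Let entire_continuous f : continuous (f : Cd -> C).
Proof.
by case: f => f hf z /=; apply: differentiable_continuous; exact/holomorphicP.
Qed.

Let entire_bounded f K : compact K ->
  exists2 M : R, 0 < M & forall z, K z -> `|f z| <= M%:C%C.
Proof.
move=> /compact_near_coveringP cK.
pose P (M : R) (z : Cd) := `|f z| <= M%:C%C.
have PM : \forall M \near +oo, K `<=` P M.
  apply: cK => z Kz; have [m m0 fm] := norm_realC (f z).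
  have nz : \forall z' \near z, `|f z - f z'| < 1.
    by have /cvgrPdist_lt := @entire_continuous f z; apply.
  exists ([set z' | `|f z - f z'| < 1], [set M | m + 1 < M]).
    split; last by exists (m + 1); split; [exact: num_real|].
    exact: nz.
  move=> [z' M] /= []; rewrite distrC => fzz' mM.
  rewrite /P -(subrK (f z) (f z')) (le_trans (ler_normD _ _))//.
  rewrite fm (le_trans (lerD (ltW fzz') (lexx _)))//.
  by rewrite -(rmorph1 (real_complex R)) -rmorphD lecR addrC ltW.
have [M [M0 KM]] := filter_ex (filterI (nbhs_pinfty_gt (num_real (0 : R))) PM).
by exists M.
Qed.

Fact entire_scale_continuous : continuous (fun p : C^o * H => p.1 *: p.2).
Proof.
move=> [a f] A /entire_nbhsP [K [e [cK e0 sA]]].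
have [M M0 fM] := entire_bounded f cK.
have [n n0 an] := norm_realC a.
pose N := n + 1; have N0 : 0 < N by rewrite ltr_wpDl.
pose del := Num.min 1 (e / 2 / M).
have del0 : 0 < del by rewrite lt_min ltr01 !divr_gt0.
exists (ball (a : C^o) del%:C%C, tube K (e / 2 / N) f \o entire_fun).
  split; first by apply: (@nbhsx_ballx C C^o); rewrite ltcR.
  by apply/entire_nbhsP; exists K, (e / 2 / N); rewrite !divr_gt0.
move=> [b g] /= []; rewrite -ball_normE /= => ab fg; apply: sA => z Kz.
have bN : `|b| <= N%:C%C.
  rewrite -(subrK a b) (le_trans (ler_normD _ _))// an distrC.
  rewrite rmorphD addrC lerD// (le_trans (ltW ab))// lecR.
  by rewrite /del ge_min lexx.
rewrite !entire_scaleE.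
have -> : a * f z - b * g z = (a - b) * f z + b * (f z - g z) by ring.
rewrite (le_lt_trans (ler_normD _ _))// !normrM [e]splitr rmorphD ler_ltD//.
  have -> : e / 2 = (e / 2 / M) * M by rewrite divfK// gt_eqF.
  rewrite rmorphM ler_pM ?fM// (le_trans (ltW ab))// lecR.
  by rewrite /del ge_min lexx orbT.
have -> : e / 2 = N * (e / 2 / N) by rewrite [RHS]mulrC divfK// gt_eqF.
have N0' : 0 < N%:C%C by rewrite ltcR.
by rewrite rmorphM (le_lt_trans (ler_wpM2r _ bN))// (ltr_pM2l N0') fg.
Qed.

Fact entire_locally_convex : exists2 B : set_system H,
  (forall b, b \in B -> convex_set b) & basis B.
Proof.
pose T K e f := [set g : H | exists2 e', e' < e &
  forall z, K z -> `|f z - g z| <= e'%:C%C].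
exists [set b | exists K e f, [/\ compact K, 0 < e & b = T K e f]].
  move=> _ /set_mem [K [e [f [_ _ ->]]]] g h l /[!inE] -[e1 e1e fg] [e2 e2e fh].
  exists (Num.max e1 e2); first by rewrite gt_max e1e.
  move=> z Kz; rewrite entire_addE !entire_scaleE.
  have -> : f z - (l%:num * g z + (1 - l%:num) * h z) =
    l%:num * (f z - g z) + (1 - l%:num) * (f z - h z) by ring.
  have l0 : 0 <= l%:num by [].
  have l1 : 0 <= 1 - l%:num by rewrite subr_ge0.
  rewrite (le_trans (ler_normD _ _))// !normrM (ger0_norm l0) (ger0_norm l1).
  have -> : (Num.max e1 e2)%:C%C =
    l%:num * (Num.max e1 e2)%:C%C + (1 - l%:num) * (Num.max e1 e2)%:C%C by ring.
  by rewrite lerD// ler_wpM2l// ?(le_trans (fg z Kz)) ?(le_trans (fh z Kz))//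
    lecR le_max lexx ?orbT.
split=> [_ [K [e [f [cK e0 ->]]]]|f A /entire_nbhsP [K [e [cK e0 sA]]]].
  rewrite openE => g [e' e'e fg]; apply/entire_nbhsP.
  exists K, ((e - e') / 2); split => //; first by rewrite divr_gt0// subr_gt0.
  move=> h gh; exists (e' + (e - e') / 2); first by lra.
  move=> z Kz.
  rewrite -(subrKA (g z)) (le_trans (ler_normD _ _))// rmorphD lerD ?fg//.
  exact/ltW/gh.
exists (T K e f).
  split; first by exists K, e, f.
  by exists 0 => // z _; rewrite subrr normr0.
move=> g [e' e'e fg]; apply: sA => z /fg fg'; apply: le_lt_trans fg' _.
by rewrite ltcR.
Qed.

HB.instance Definition _ :=
  PreTopologicalNmodule_isTopologicalNmodule.Build H entire_add_continuous.
HB.instance Definition _ :=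
  TopologicalNmodule_isTopologicalLmodule.Build C H entire_scale_continuous.
HB.instance Definition _ := Uniform_isTvs.Build C H entire_locally_convex.
End EntireTopology.

Local Notation normc := ComplexField.Normc.normc.

Section LocallyConvex.
Context (R : realType) (V : tvsType R[i]).

Definition continuous_seminorm : set (V -> R) := [set q |
  [/\ forall u v, q (u + v) <= q u + q v,
      forall (a : R[i]) v, q (a *: v) = normc a * q v
    & continuous q]].

Record cont_endo := ContEndo {
  cont_endo_fun :> {linear V -> V} ;
  cont_endo_continuous : continuous cont_endo_fun }.

End LocallyConvex.

Section SpecialLinear.
Context (R : realType) (d : nat).
Local Notation C := R[i].

Definition traceless : {pred 'M[C]_d} := fun A => \tr A == 0.

Fact traceless_submod : submod_closed traceless.
Proof.
split; first by rewrite unfold_in mxtrace0.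
move=> a A B /eqP hA /eqP hB.
by rewrite unfold_in mxtraceD mxtraceZ hA hB mulr0 addr0.
Qed.

HB.instance Definition _ := GRing.isSubmodClosed.Build C 'M[C]_d traceless
  traceless_submod.

Record sl := Sl { sl_mx :> 'M[C]_d ; _ : sl_mx \in traceless }.

HB.instance Definition _ := [isSub for sl_mx].
HB.instance Definition _ := [Choice of sl by <:].
HB.instance Definition _ := [SubChoice_isSubLmodule of sl by <:].

Fact sl_bracket_subproof (X Y : sl) : X *m Y - Y *m X \in traceless.
Proof. by rewrite unfold_in raddfB /= mxtrace_mulC subrr. Qed.

Definition sl_bracket (X Y : sl) : sl := Sl (sl_bracket_subproof X Y).

Definition frobenius (A : 'M[C]_d) : R :=
  Num.sqrt (\sum_i \sum_j normc (A i j) ^+ 2).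

Definition sl_ball : set sl := [set X | frobenius X < 1].

(* sl_d is regarded as a real Lie algebra: only real scalars have to be
   preserved. *)
Record representation (V : tvsType C) := Representation {
  rep_fun :> sl -> cont_endo V ;
  repD : forall X Y v, rep_fun (X + Y) v = rep_fun X v + rep_fun Y v ;
  repZ : forall (t : R) X v, rep_fun (t%:C%C *: X) v = t%:C%C *: rep_fun X v ;
  rep_bracket : forall X Y v, rep_fun (sl_bracket X Y) v =
    rep_fun X (rep_fun Y v) - rep_fun Y (rep_fun X v) }.

End SpecialLinear.

Section EntireVectors.
Context (R : realType) (d : nat) (V : tvsType R[i]) (rho : representation d V).

Definition word_action (xs : seq (sl R d)) (v : V) : V :=
  foldr (fun X w => rho X w) v xs.

(* p^(s)_(r,q) *)
Definition entire_seminorm (s r : R) (q : V -> R) (v : V) : \bar R :=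
  (\sum_(0 <= n <oo) (n`!%:R `^ (s - 1) * r ^+ n)%:E *
    ereal_sup [set (q (word_action xs v))%:E | xs in
      [set xs : n.-tuple (sl R d) | forall i, sl_ball (tnth xs i)]])%E.

Definition entire_vectors (s : R) : set V :=
  [set v | forall q r, continuous_seminorm q -> 0 <= r ->
    (entire_seminorm s r q v < +oo)%E].

(* Open sets of the locally convex topology on [entire_vectors s] (not on V)
   generated by the seminorms p^(s)_(r,q): around each of its points, U contains
   the intersection of finitely many seminorm balls. *)
Definition entire_open (s : R) : set_system V :=
  [set U | U `<=` entire_vectors s /\ forall v, U v ->
    exists (k : nat) (r : 'I_k -> R) (q : 'I_k -> V -> R) (e : R),
    [/\ forall i, 0 <= r i, forall i, continuous_seminorm (q i), 0 < e &
        forall w, entire_vectors s w ->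
          (forall i, (entire_seminorm s (r i) (q i) (w - v)%R < e%:E)%E) -> U w]].

End EntireVectors.

(* The operator z^n d/dz^m by which the matrix unit E_nm acts. *)
Definition unit_action (R : realType) (d : nat) (n m : 'I_d)
    (f : 'rV[R[i]]_d -> R[i]) (z : 'rV[R[i]]_d) : R[i] :=
  z 0 n * 'D_(delta_mx 0 m) f z.

(* E_nn is not traceless, so "given on matrix units, extended linearly" is read
   as the restriction to sl_d of the linear extension to all of Mat_d. *)
Definition acts_by_vector_fields (R : realType) (d : nat)
    (rho : representation d (entire R d)) : Prop :=
  forall (A : sl R d) (f : entire R d) (z : 'rV[R[i]]_d),
    rho A f z = \sum_n \sum_m A n m * unit_action n m f z.

(* Main.v *)
Require Import Defs.
From HB Require Import structures.
From mathcomp Require Import all_boot all_order all_algebra.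
From mathcomp Require Import all_classical all_reals all_analysis.
From mathcomp Require Import complex ring lra.

(** Let A act on an entire function f by the linear vector field
    (A f)(z) = 'D_(z A) f z.  On the line z + t (z A), Cauchy's estimate for an
    entire function of the single variable t gives, for every del > 0,
      sup_(P_r) |A f| <= del^-1 * sup_(P_(r (1 + d del))) |f|,
    where P_r is the closed polydisc of radius r and A is in the unit ball of
    the Frobenius norm.  Iterating n times with del = s / n, the radii stay
    below r e^(d s) because (1 + d s / n)^n <= e^(d s), and the constants
    multiply to (n / s)^n <= n! (e / s)^n.  Hence
      sup_(P_r) |A_1 ... A_n f| <= n! (e / s)^n sup_(P_(r e^(d s))) |f|,
    with s > 0 as large as desired.  The weight n!^-1 of order 0 cancels the
    factorial, so the series defining p_(t,q)(f) is dominated by a geometric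
    one and is bounded by a multiple of a sup norm of f
    ([entire_seminorm_bound]).  Every f is therefore an entire vector, and the
    topology of the p_(t,q) is coarser than that of H(C^d).  It is also finer,
    since the zeroth term of p_(0,q)(f) is q(f) ([le_entire_seminorm]).

    This needs complex analysis in one variable, starting from mere complex
    differentiability.
    - Goursat's bisection argument shows that an entire function has an entire
      primitive ([entire_primitive]).
    - Let F be a primitive of f(e^w) e^-w.  As the integrand has period
      2 pi i, the increment of F along that period does not depend on w;
      letting Re w tend to -oo identifies it as 2 pi i f'(0), while the mean
      value inequality on Re w = ln rho bounds it by 2 pi sup_(|z| = rho) |f| / rho.
      This is Cauchy's estimate ([cauchy_estimate]).
    - Applied to differences of translates of f, Cauchy's estimate bounds the
      second-order Taylor remainder ([taylor2_bound]).  For two variables it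
      makes the difference quotients of a partial derivative a Cauchy family,
      whence mixed derivatives with quadratic remainders
      ([mixed_derivative]).  So a directional derivative of an entire function
      on C^d is entire and directional derivatives commute.
    The last point is what makes the representation exist: the vector fields
    preserve H(C^d), and the second-order terms of A B f - B A f cancel. *)

Set Implicit Arguments.
Unset Strict Implicit.
Unset Printing Implicit Defensive.

Import Order.TTheory GRing.Theory Num.Theory.
Import numFieldNormedType.Exports.
Import ComplexField.Normc.

Local Open Scope classical_set_scope.
Local Open Scope ring_scope.
Local Open Scope complex_scope.

(** * Modulus of complex numbers *)

Section ComplexModulus.
Variable R : realType.
Implicit Types (x y : R) (z w : R[i]).

Lemma normcE z : `|z| = (normc z)%:C.
Proof. by case: z. Qed.

Lemma normc_real x : normc x%:C = `|x|.
Proof. by rewrite /= expr0n addr0 sqrtr_sqr. Qed.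

Lemma normc_i : normc 'i = 1 :> R.
Proof. by rewrite /= expr0n add0r expr1n sqrtr1. Qed.

Lemma normc_ge0 z : 0 <= normc z.
Proof. by case: z => a b; exact: sqrtr_ge0. Qed.

Lemma normc_lt z x : (`|z| < x%:C) = (normc z < x).
Proof. by rewrite normcE ltcR. Qed.

Lemma normc_le z x : (`|z| <= x%:C) = (normc z <= x).
Proof. by rewrite normcE lecR. Qed.

Lemma normcB z w : normc (z - w) = normc (w - z).
Proof. by rewrite -normcN opprB. Qed.

Lemma normc_eq0 z : (normc z == 0) = (z == 0).
Proof.
apply/eqP/eqP => [/eq0_normc //|->].
exact: normc0.
Qed.

Lemma normc_gt0 z : (0 < normc z) = (z != 0).
Proof. by rewrite lt_def normc_ge0 andbT normc_eq0. Qed.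

Lemma ler_Re_normc z : `|complex.Re z| <= normc z.
Proof.
by case: z => a b /=; rewrite -sqrtr_sqr ler_wsqrtr// lerDl sqr_ge0.
Qed.

Lemma ler_Im_normc z : `|complex.Im z| <= normc z.
Proof.
by case: z => a b /=; rewrite -sqrtr_sqr ler_wsqrtr// lerDr sqr_ge0.
Qed.

Lemma ler_normc_ReIm z : normc z <= `|complex.Re z| + `|complex.Im z|.
Proof.
rewrite {1}[z]complexE (le_trans (le_normcD _ _))//.
by rewrite normcM normc_i mul1r !normc_real.
Qed.

Lemma conj_mulc z : complex.Re (z^* * z) = normc z ^+ 2.
Proof.
case: z => a b /=; rewrite sqr_sqrtr ?addr_ge0 ?sqr_ge0//.
by rewrite mulNr opprK !expr2.
Qed.

Lemma normc_conj z : normc z^* = normc z.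
Proof. by case: z => a b /=; rewrite sqrrN. Qed.

End ComplexModulus.

(** * Paths in the complex plane *)

Section RealPaths.
Variable R : realType.
Local Notation C := R[i].
Implicit Types (phi : R -> C) (t : R).

(** Derivative with respect to the real parameter of a path. *)
Definition rderiv phi t (c : C) := forall e : R, 0 < e ->
  exists2 del : R, 0 < del & forall h : R, `|h| < del ->
    normc (phi (t + h) - phi t - h%:C * c) <= e * `|h|.

Lemma Re_is_derive phi t c (u : C) : rderiv phi t c ->
  is_derive t 1 (fun s => complex.Re (u * phi s)) (complex.Re (u * c)).
Proof.
move=> pc.
have H : (fun h : R => h^-1 *: (complex.Re (u * phi (h *: (1:R) + t))
    - complex.Re (u * phi t))) @ 0^' --> complex.Re (u * c).
  apply/cvgrPdist_le => e e0.
  have N0 : 0 < normc u + 1 by rewrite ltr_wpDl ?normc_ge0.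
  have [d d0 H] := pc (e / (normc u + 1)) (divr_gt0 e0 N0).
  rewrite near_withinE; exists d => //= h /=; rewrite sub0r normrN => hd h0.
  have := H _ hd; set r := _ - _ - _ => Hr.
  have -> : complex.Re (u * c) - h^-1 *: (complex.Re (u * phi (h *: (1:R) + t))
      - complex.Re (u * phi t)) = - (h^-1 * complex.Re (u * r)).
    rewrite /GRing.scale/= mulr1 (addrC h t).
    have -> : complex.Re (u * r) = complex.Re (u * phi (t + h))
        - complex.Re (u * phi t) - h * complex.Re (u * c).
      rewrite /r; case: (u) (phi (t+h)) (phi t) (c) => ? ? [? ?] [? ?] [? ?] /=; ring.
    by field.
  rewrite normrN normrM normfV ler_pdivrMl ?normr_gt0//.
  apply: (le_trans (ler_Re_normc _)).
  rewrite normcM.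
  apply: (le_trans (ler_wpM2l (normc_ge0 _) Hr)).
  rewrite mulrA [leRHS]mulrC ler_wpM2r// mulrA ler_pdivrMr//.
  by rewrite mulrC ler_wpM2l ?(ltW e0)// lerDl.
by split; [apply/cvg_ex; eexists; exact: H | exact/cvg_lim].
Qed.

(** Projecting onto the direction of the increment reduces to the real mean
    value theorem.  The points between a and b are described symmetrically,
    which covers both orders of a and b. *)
Lemma mean_value_ineq phi (dphi : R -> C) (M a b : R) :
  (forall t, rderiv phi t (dphi t)) ->
  (forall t, `|t - a| <= `|b - a| -> `|t - b| <= `|b - a| ->
     normc (dphi t) <= M) ->
  normc (phi b - phi a) <= M * `|b - a|.
Proof.
move=> dp.
wlog ab : a b / a <= b => [H|] HM.
  have [ab|ba] := leP a b; first exact: (H _ _ ab HM).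
  rewrite normcB distrC; apply: (H _ _ (ltW ba)) => t tb ta.
  by apply: HM; rewrite (distrC b).
set D := phi b - phi a.
have drv t := Re_is_derive D^* (dp t).
have [|c cab E] := MVT_segment ab (fun t _ => drv t).
  apply: continuous_subspaceT => t; apply: differentiable_continuous.
  by apply/derivable1_diffP; case: (drv t).
have E' : normc D ^+ 2 = complex.Re (D^* * dphi c) * (b - a).
  rewrite -E -conj_mulc /D.
  by case: (phi a) (phi b) => ? ? [? ?] /=; ring.
have [D0|D0] := eqVneq (normc D) 0.
  rewrite D0 mulr_ge0//; apply: le_trans (HM a _ _); first exact: normc_ge0.
  - by rewrite subrr normr0.
  - by rewrite distrC.
have Dp : 0 < normc D by rewrite lt_def D0 normc_ge0.
rewrite -(ler_pM2l Dp) -expr2 E' ger0_norm ?subr_ge0// mulrA.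
rewrite ler_wpM2r ?subr_ge0// (le_trans (ler_norm _))// (le_trans (ler_Re_normc _))//.
rewrite normcM normc_conj ler_wpM2l ?normc_ge0//.
move: cab; rewrite in_itv/= => /andP[ac cb]; apply: HM.
  by rewrite !ger0_norm ?subr_ge0// lerD2r.
by rewrite distrC !ger0_norm ?subr_ge0// lerD2l lerN2.
Qed.

Lemma is_derive_increment (F : R -> R) (t l e : R) :
  is_derive t 1 F l -> 0 < e ->
  exists2 d : R, 0 < d &
    forall h, `|h| < d -> `|F (t + h) - F t - h * l| <= e * `|h|.
Proof.
move=> [dF dFE] e0.
move: dF => /cvg_ex [k Hk]; have kl : k = l by rewrite -dFE; apply/esym/cvg_lim.
move/cvgrPdist_le : Hk => /(_ e e0); rewrite near_withinE => -[d d0 H].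
exists d => // h hd; have [->|h0] := eqVneq h 0.
  by rewrite addr0 mul0r !subrr normr0 mulr0.
have /= := H h; rewrite sub0r normrN => /(_ hd h0).
rewrite kl /GRing.scale/= mulr1 (addrC h t) => He.
have -> : F (t + h) - F t - h * l = - (l - h^-1 * (F (t + h) - F t)) * h by field.
by rewrite normrM normrN ler_wpM2r.
Qed.

(** The fundamental theorem of calculus differentiates the integral from a
    fixed left endpoint, at points to its right.  To get a primitive on the
    whole line, the endpoint -(|x| + 1) moves with x; normalizing at 0 makes
    the resulting functions agree where they overlap. *)
Lemma real_primitive (f : R -> R) : continuous f ->
  exists F : R -> R, forall x : R, is_derive x 1 F (f x).
Proof.
move=> cf.
pose mu := @lebesgue_measure R.
have itf a b : mu.-integrable `[a, b] (EFin \o f).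
  apply: continuous_compact_integrable; first exact: segment_compact.
  exact: continuous_subspaceT.
pose P (N x : R) := (\int[mu]_(t in `[- N, x]) f t)%R.
pose F x := P (`|x| + 1) x - P (`|x| + 1) 0.
have shift N N' x y : `|x| < N -> `|y| < N -> N <= N' -> P N x - P N y = P N' x - P N' y.
  move=> xN yN NN'.
  suff H z : `|z| < N -> P N' z - P N z = P N' (- N).
    have := H _ xN; have := H _ yN; lra.
  move=> zN; have z1 : - N <= z by move: zN; rewrite ltr_norml => /andP[/ltW].
  have zz : (BLeft (- N') <= BRight (- N))%O by rewrite bnd_simp; lra.
  have Nz : (BRight (- N) <= BRight z)%O by rewrite bnd_simp.
  have := Rintegral_itvB (itf _ _) zz Nz.
  rewrite Rintegral_itv_obnd_cbnd.
    by rewrite /P => <-; lra.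
  by apply: integrableS (itf (- N) z) => //; apply: subset_itvr; rewrite bnd_simp.
exists F => x.
pose N := `|x| + 2.
have := @continuous_FTC1_closed R f (- N) x (x + 1).
have xx : x < x + 1 by rewrite ltrDl.
have Nx : - N < x by have := ler_norm (- x); rewrite normrN /N; lra.
move=> /(_ xx (itf _ _) Nx (cf x)) [dF FE].
have eqF : \forall y \near x, P N y - P N 0 = F y.
  exists 1 => //= y xy; rewrite /F; symmetry; apply: shift.
  - by rewrite ltrDl.
  - by rewrite normr0 ltr_wpDl.
  - rewrite /N; have := ler_normD (y - x) x; rewrite subrK.
    by move: xy; rewrite /= distrC; lra.
apply: near_eq_is_derive eqF _.
have E : is_derive x 1 (P N) (f x).
  by split=> //; rewrite -derive1E.
have -> : (fun y => P N y - P N 0) = P N - cst (P N 0) by [].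
by apply: is_derive_eq; rewrite subr0.
Qed.

Lemma path_primitive phi :
  (forall t e, 0 < e -> exists2 d : R, 0 < d &
     forall s, `|s - t| < d -> normc (phi s - phi t) <= e) ->
  exists Phi : R -> C, forall t, rderiv Phi t (phi t).
Proof.
move=> cphi.
have cpart (p : C -> R) : (forall z w, p (z - w) = p z - p w) ->
    (forall z, `|p z| <= normc z) -> continuous (p \o phi).
  move=> pB pn t; apply/cvgrPdist_le => e e0.
  have [d d0 H] := cphi t e e0.
  exists d => //= s ts; rewrite distrC -pB (le_trans (pn _))// H//.
  by rewrite distrC.
have [F1 dF1] := real_primitive (cpart (@complex.Re R)
  (fun z w => raddfB (@complex.Re R) z w) (@ler_Re_normc R)).
have [F2 dF2] := real_primitive (cpart (@complex.Im R)
  (fun z w => raddfB (@complex.Im R) z w) (@ler_Im_normc R)).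
exists (fun t => F1 t +i* F2 t) => t e e0.
have e20 : 0 < e / 2 by rewrite divr_gt0.
have [d1 d10 H1] := is_derive_increment (dF1 t) e20.
have [d2 d20 H2] := is_derive_increment (dF2 t) e20.
exists (Num.min d1 d2) => [|h]; rewrite lt_min ?d10// => /andP[h1 h2].
rewrite (le_trans (ler_normc_ReIm _))// [e]splitr mulrDl lerD//.
  apply: le_trans (H1 _ h1); rewrite le_eqVlt; apply/orP; left; apply/eqP; congr `|_|.
  by rewrite /comp/=; case: (phi t) => ? ? /=; ring.
apply: le_trans (H2 _ h2); rewrite le_eqVlt; apply/orP; left; apply/eqP; congr `|_|.
by rewrite /comp/=; case: (phi t) => ? ? /=; ring.
Qed.

End RealPaths.

(** * Complex derivatives *)

Section ComplexDerivative.
Variable R : realType.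
Local Notation C := R[i].
Implicit Types (f g : C -> C) (z w c : C).

Definition cderiv f z c := forall e : R, 0 < e ->
  exists2 del : R, 0 < del & forall h : C, normc h < del ->
    normc (f (z + h) - f z - h * c) <= e * normc h.

Lemma cderiv_eq f g z c c' : f =1 g -> c = c' -> cderiv f z c -> cderiv g z c'.
Proof. by move=> /funext -> ->. Qed.

Lemma cderiv_continuous f z c : cderiv f z c -> forall e : R, 0 < e ->
  exists2 d : R, 0 < d & forall w, normc (w - z) < d -> normc (f w - f z) <= e.
Proof.
move=> fc e e0; have [d d0 H] := fc 1 ltr01.
have N0 : 0 < 1 + normc c by rewrite ltr_wpDr ?normc_ge0.
exists (Num.min d (e / (1 + normc c))) => [|w]; first by rewrite lt_min d0 divr_gt0.
rewrite lt_min => /andP[wd we]; have := H _ wd; rewrite subrKC => Hw.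
rewrite -(subrK ((w - z) * c) (f w - f z)) (le_trans (le_normcD _ _))//.
apply: (le_trans (lerD Hw (lexx _))).
rewrite normcM mul1r -[X in X + _]mulr1 -mulrDr.
by rewrite -ler_pdivlMr// ltW.
Qed.

Lemma cderiv_line f z v (t : R) c : cderiv f (z + t%:C * v) c ->
  rderiv (fun s => f (z + s%:C * v)) t (v * c).
Proof.
move=> fc e e0; have N0 : 0 < normc v + 1 by rewrite ltr_wpDl ?normc_ge0.
have [d d0 H] := fc (e / (normc v + 1)) (divr_gt0 e0 N0).
exists (d / (normc v + 1)) => [|h hd]; first by rewrite divr_gt0.
have nhv : normc (h%:C * v) <= `|h| * (normc v + 1).
  by rewrite normcM normc_real ler_wpM2l// lerDl.
have := H (h%:C * v); rewrite (le_lt_trans nhv); last by rewrite -ltr_pdivlMr.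
move=> /(_ isT) Hh; rewrite rmorphD mulrDl addrA mulrA (le_trans Hh)//.
apply: le_trans (ler_wpM2l _ nhv) _; first by rewrite divr_ge0 ?ltW.
by rewrite mulrCA divfK ?gt_eqF// mulrC.
Qed.

Lemma cderivD f g z c c' : cderiv f z c -> cderiv g z c' ->
  cderiv (fun w => f w + g w) z (c + c').
Proof.
move=> fc gc e e0; have e20 : 0 < e / 2 by rewrite divr_gt0.
have [d d0 H] := fc _ e20; have [d' d'0 H'] := gc _ e20.
exists (Num.min d d') => [|h]; rewrite lt_min ?d0// => /andP[hd hd'].
rewrite (_ : _ - _ = (f (z + h) - f z - h * c) + (g (z + h) - g z - h * c')).
  by rewrite (le_trans (le_normcD _ _))// [e]splitr mulrDl lerD ?H ?H'.
by ring.
Qed.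

Lemma cderiv_comp f g z c c' : cderiv g z c' -> cderiv f (g z) c ->
  cderiv (f \o g) z (c' * c).
Proof.
move=> gc fc e e0.
have N0 : 0 < normc c + 1 by rewrite ltr_wpDl ?normc_ge0.
have N'0 : 0 < normc c' + 1 by rewrite ltr_wpDl ?normc_ge0.
have e1 : 0 < e / 2 / (normc c' + 1) by rewrite !divr_gt0.
have e2 : 0 < e / 2 / (normc c + 1) by rewrite !divr_gt0.
have [d d0 H] := fc _ e1.
have [d1 d10 H1] := gc _ e2; have [d2 d20 H2] := gc _ ltr01.
exists (Num.min (d / (normc c' + 1)) (Num.min d1 d2)) => [|h].
  by rewrite !lt_min d10 d20 divr_gt0.
rewrite !lt_min => /and3P[h0 h1 h2].
set k := g (z + h) - g z.
have kh : normc k <= normc h * (normc c' + 1).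
  rewrite -(subrK (h * c') k) (le_trans (le_normcD _ _))//.
  rewrite (le_trans (lerD (H2 _ h2) (lexx _)))// mul1r.
  by rewrite normcM mulrDr mulr1 addrC.
have kd : normc k < d by rewrite (le_lt_trans kh)// -ltr_pdivlMr.
have Hk := H _ kd; have Hh := H1 _ h1.
have gzh : g (z + h) = g z + k by rewrite /k subrKC.
rewrite /= gzh.
have -> : f (g z + k) - f (g z) - h * (c' * c) =
   (f (g z + k) - f (g z) - k * c) + (k - h * c') * c by ring.
rewrite (le_trans (le_normcD _ _))// [e in leRHS]splitr [leRHS]mulrDl lerD//; last first.
  rewrite normcM.
  apply: le_trans (ler_wpM2r (normc_ge0 _) Hh) _.
  rewrite mulrAC ler_wpM2r ?normc_ge0// mulrAC ler_pdivrMr//.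
  by rewrite ler_wpM2l ?lerDl// ltW// divr_gt0.
apply: le_trans Hk _; apply: le_trans (ler_wpM2l (ltW e1) kh) _.
by rewrite mulrCA divfK ?gt_eqF// mulrC.
Qed.

Lemma cderiv_quadratic f z c (K : R) :
  (forall h, normc h <= 1 / 2 -> normc (f (z + h) - f z - h * c) <= K * normc h ^+ 2) ->
  cderiv f z c.
Proof.
move=> H e e0; have N0 : 0 < `|K| + 1 by rewrite ltr_wpDl.
exists (Num.min (1 / 2) (e / (`|K| + 1))) => [|h]; first by rewrite lt_min !divr_gt0.
rewrite lt_min => /andP[/ltW h1 h2]; apply: le_trans (H _ h1) _.
rewrite expr2 mulrA ler_wpM2r ?normc_ge0//.
rewrite (le_trans (ler_wpM2r (normc_ge0 _) (ler_norm K)))//.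
apply: (le_trans (y := (`|K| + 1) * normc h)).
  by rewrite ler_wpM2r ?normc_ge0// lerDl.
by rewrite mulrC -ler_pdivlMr// ltW.
Qed.

(** Quadratic polynomials include all the affine and constant functions, hence
    serve as the source of elementary derivatives. *)
Lemma cderiv_quad (a b d z : C) :
  cderiv (fun w => a + b * w + d * w ^+ 2) z (b + 2%:R * d * z).
Proof.
apply: (@cderiv_quadratic _ _ _ (normc d)) => h _.
rewrite (_ : _ - _ = d * (h * h)); last by ring.
by rewrite !normcM -expr2.
Qed.

Lemma cderivM f g z c c' : cderiv f z c -> cderiv g z c' ->
  cderiv (fun w => f w * g w) z (c * g z + f z * c').
Proof.
(* Polarization: f g = ((f + g)^2 - (f - g)^2) / 4 reduces to the chain rule. *)
move=> fc gc.
have sq h b : cderiv h z b -> cderiv (fun w => (h w) ^+ 2 / 4) z (b * h z / 2).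
  move=> hb; apply: cderiv_eq (cderiv_comp hb (cderiv_quad 0 0 4^-1 (h z))).
    by move=> w /=; field.
  by field.
have opp h b : cderiv h z b -> cderiv (fun w => - h w) z (- b).
  move=> hb; apply: cderiv_eq (cderiv_comp hb (cderiv_quad 0 (-1) 0 (h z))).
    by move=> w /=; ring.
  by ring.
apply: cderiv_eq (cderivD (sq _ _ (cderivD fc gc))
                  (opp _ _ (sq _ _ (cderivD fc (opp _ _ gc))))).
  by move=> w /=; field.
by field.
Qed.

Lemma cderivZ (a : C) f z c : cderiv f z c -> cderiv (fun w => a * f w) z (a * c).
Proof.
move=> fc; apply: cderiv_eq (cderivM (cderiv_quad a 0 0 z) fc).
  by move=> w /=; ring.
by ring.
Qed.

Lemma cderivB f g z c c' : cderiv f z c -> cderiv g z c' ->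
  cderiv (fun w => f w - g w) z (c - c').
Proof.
move=> fc gc; apply: cderiv_eq (cderivD fc (cderivZ (-1) gc)).
  by move=> w /=; ring.
by ring.
Qed.

Lemma cderiv_shift f z w c : cderiv f (z + w) c -> cderiv (fun u => f (u + w)) z c.
Proof.
move=> fc e e0; have [d d0 H] := fc e e0.
by exists d => // h hd; rewrite [z + h + w]addrAC H.
Qed.

Lemma cmean_value f (df : C -> C) z h (M : R) :
  (forall w, cderiv f w (df w)) ->
  (forall t : R, 0 <= t <= 1 -> normc (df (z + t%:C * h)) <= M) ->
  normc (f (z + h) - f z) <= M * normc h.
Proof.
move=> fd HM.
have := @mean_value_ineq R (fun t => f (z + t%:C * h)) (fun t => h * df (z + t%:C * h))
  (M * normc h) 0 1 (fun t => cderiv_line (fd _)).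
rewrite /= mul1r mul0r addr0 subr0 normr1 mulr1; apply => t t0 t1.
rewrite normcM mulrC ler_wpM2r ?normc_ge0// HM//.
by move: t0 t1; rewrite subr0 !ler_norml => /andP[? ?] /andP[? ?]; lra.
Qed.

End ComplexDerivative.

(** * Bisection of rectangles *)

Section Goursat.
Variable R : realType.
Local Notation C := R[i].

Lemma nested_intervals (a b : nat -> R) :
  (forall n, a n <= a n.+1) -> (forall n, b n.+1 <= b n) ->
  (forall n, a n <= b n) -> exists p, forall n, a n <= p <= b n.
Proof.
move=> an bn ab.
have am : {homo a : n m / (n <= m)%N >-> n <= m} by exact/nondecreasing_seqP.
have bm : {homo b : n m / (n <= m)%N >-> n >= m} by exact/nonincreasing_seqP.
have ub m n : a n <= b m.
  rewrite (le_trans (am _ _ (leq_maxl n m)))// (le_trans (ab _))//.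
  exact/bm/leq_maxr.
exists (sup (range a)) => n; apply/andP; split.
  by apply: ub_le_sup; [exists (b 0%N) => _ [m _ <-]|exists n].
by apply: ge_sup; [exists (a 0%N), 0%N|move=> _ [m _ <-]].
Qed.

Lemma exp2_small (s d : R) : 0 < d -> exists n, s / 2 ^+ n < d.
Proof.
move=> d0; set n := Num.bound `|s / d|; exists n.
rewrite ltr_pdivrMr ?exprn_gt0// mulrC -ltr_pdivrMr// (le_lt_trans (ler_norm _))//.
apply: lt_trans (archi_boundP (normr_ge0 _)) _.
by rewrite -natrX ltr_nat ltn_expl.
Qed.

(** Goursat's argument.  Some quarter of a rectangle carries at least a quarter
    of |I|.  Iterating, the nested rectangles shrink to a point, their squared
    half-perimeters shrinking also by 4 at each step, so the local
    estimate at that point gives |I| <= e s^2 for all e > 0. *)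
Lemma rectangle_bisection (I : R -> R -> R -> R -> C) :
  (forall x0 xm x1 y0 ym y1, I x0 x1 y0 y1 =
     I x0 xm y0 ym + I xm x1 y0 ym + I x0 xm ym y1 + I xm x1 ym y1) ->
  (forall (px py e : R), 0 < e -> exists2 d : R, 0 < d &
     forall x0 x1 y0 y1, x0 <= px <= x1 -> y0 <= py <= y1 ->
       x1 - x0 + (y1 - y0) < d ->
       normc (I x0 x1 y0 y1) <= e * (x1 - x0 + (y1 - y0)) ^+ 2) ->
  forall x0 x1 y0 y1, x0 <= x1 -> y0 <= y1 -> I x0 x1 y0 y1 = 0.
Proof.
move=> Isplit Iloc x0 x1 y0 y1 x01 y01.
pose Q := ((R * R) * (R * R))%type.
pose J (q : Q) := normc (I q.1.1 q.1.2 q.2.1 q.2.2).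
have half (q : Q) : exists q' : Q, [/\ J q <= 4 * J q',
    q.1.1 <= q.1.2 -> [/\ q.1.1 <= q'.1.1, q'.1.2 <= q.1.2
      & q'.1.2 - q'.1.1 = (q.1.2 - q.1.1) / 2] &
    q.2.1 <= q.2.2 -> [/\ q.2.1 <= q'.2.1, q'.2.2 <= q.2.2
      & q'.2.2 - q'.2.1 = (q.2.2 - q.2.1) / 2]].
  case: q => -[a b] [c d] /=.
  pose m := (a + b) / 2; pose n := (c + d) / 2.
  pose quarters : seq Q := [:: ((a, m), (c, n)); ((m, b), (c, n));
    ((a, m), (n, d)); ((m, b), (n, d))].
  suff [q' [q'in Jq']] : exists q', q' \in quarters /\ J ((a, b), (c, d)) <= 4 * J q'.
    exists q'; split => // [ab|cd]; move: q'in; rewrite !inE => /or4P[] /eqP -> /=;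
      by rewrite /m /n; split; lra.
  apply: contrapT => /forallNP noq.
  have {}noq q' : q' \in quarters -> 4 * J q' < J ((a, b), (c, d)).
    by move=> q'in; rewrite ltNge; apply/negP => le; apply: (noq q').
  have := noq ((a, m), (c, n)); have := noq ((m, b), (c, n)).
  have := noq ((a, m), (n, d)); have := noq ((m, b), (n, d)).
  rewrite !inE !eqxx ?orbT => /(_ isT) h4 /(_ isT) h3 /(_ isT) h2 /(_ isT) h1.
  have : J ((a, b), (c, d)) <= J ((a, m), (c, n)) + J ((m, b), (c, n))
      + J ((a, m), (n, d)) + J ((m, b), (n, d)).
    rewrite {1}/J /= (Isplit a m b c n d).
    by do 3![rewrite (le_trans (le_normcD _ _))// lerD2r].
  by lra.
have [step Hstep] := choice half.
pose q n := iter n step ((x0, x1), (y0, y1)).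
have qP n : [/\ J (q 0%N) <= 4 ^+ n * J (q n),
    (q n).1.2 - (q n).1.1 = (x1 - x0) / 2 ^+ n &
    (q n).2.2 - (q n).2.1 = (y1 - y0) / 2 ^+ n].
  elim: n => [|n [Jn xn yn]]; first by rewrite !expr0 !mul1r !divr1.
  have [Js xs ys] := Hstep (q n).
  have p0 : (0 : R) < 2 ^+ n by rewrite exprn_gt0.
  have /xs[_ _ xs'] : (q n).1.1 <= (q n).1.2.
    by rewrite -subr_ge0 xn divr_ge0 ?subr_ge0// ltW.
  have /ys[_ _ ys'] : (q n).2.1 <= (q n).2.2.
    by rewrite -subr_ge0 yn divr_ge0 ?subr_ge0// ltW.
  split.
  - apply: le_trans Jn _; rewrite exprSr -mulrA ler_wpM2l// ?exprn_ge0//.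
  - by rewrite /= xs' xn exprSr invfM mulrA.
  - by rewrite /= ys' yn exprSr invfM mulrA.
have xle n : (q n).1.1 <= (q n).1.2.
  by have [_ xn _] := qP n; rewrite -subr_ge0 xn divr_ge0 ?subr_ge0// exprn_ge0.
have yle n : (q n).2.1 <= (q n).2.2.
  by have [_ _ yn] := qP n; rewrite -subr_ge0 yn divr_ge0 ?subr_ge0// exprn_ge0.
have [|||px Hpx] := @nested_intervals (fun n => (q n).1.1) (fun n => (q n).1.2) => //.
  by move=> n; have [_ /(_ (xle n))[]] := Hstep (q n).
  by move=> n; have [_ /(_ (xle n))[]] := Hstep (q n).
have [|||py Hpy] := @nested_intervals (fun n => (q n).2.1) (fun n => (q n).2.2) => //.
  by move=> n; have [_ _ /(_ (yle n))[]] := Hstep (q n).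
  by move=> n; have [_ _ /(_ (yle n))[]] := Hstep (q n).
set s := x1 - x0 + (y1 - y0).
have small (e : R) : 0 < e -> J (q 0%N) <= e * s ^+ 2.
  move=> e0; have [d d0 Hd] := Iloc px py e e0.
  have [n sn] := exp2_small s d0.
  have [Jn xn yn] := qP n.
  have snE : (q n).1.2 - (q n).1.1 + ((q n).2.2 - (q n).2.1) = s / 2 ^+ n.
    by rewrite xn yn -mulrDl.
  have := Hd _ _ _ _ (Hpx n) (Hpy n); rewrite snE => /(_ sn) Hn.
  have p4 : (0 : R) < 4 ^+ n by rewrite exprn_gt0.
  apply: le_trans Jn _; apply: le_trans (ler_wpM2l (ltW p4) Hn) _.
  have -> : (4 : R) ^+ n = 2 ^+ n ^+ 2 by rewrite -exprM mulnC exprM; congr (_ ^+ _); ring.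
  have p2 : (2 : R) ^+ n != 0 by rewrite expf_neq0.
  rewrite le_eqVlt; apply/orP; left; apply/eqP; field; exact: p2.
apply/eqP; rewrite -normc_eq0 eq_le normc_ge0 andbT.
apply/ler_addgt0Pr => e e0; rewrite add0r.
have S0 : 0 < s ^+ 2 + 1 by rewrite ltr_wpDl ?sqr_ge0.
apply: le_trans (small (e / (s ^+ 2 + 1)) (divr_gt0 e0 S0)) _.
by rewrite mulrAC ler_pdivrMr// ler_wpM2l ?ltW// ltrDl.
Qed.

End Goursat.

(** * Primitives of entire functions *)

Section EntirePrimitive.
Variable R : realType.
Local Notation C := R[i].

Lemma rderivB (phi psi : R -> C) t c c' : rderiv phi t c -> rderiv psi t c' ->
  rderiv (fun s => phi s - psi s) t (c - c').
Proof.
move=> pc qc e e0; have e20 : 0 < e / 2 by rewrite divr_gt0.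
have [d d0 H] := pc _ e20; have [d' d'0 H'] := qc _ e20.
exists (Num.min d d') => [|h]; rewrite lt_min ?d0// => /andP[hd hd'].
rewrite (_ : _ - _ = (phi (t + h) - phi t - h%:C * c) - (psi (t + h) - psi t - h%:C * c')).
  by rewrite (le_trans (le_normcD _ _))// normcN [e]splitr mulrDl lerD ?H ?H'.
by ring.
Qed.

(** The case of a derivative close to a constant k: subtract the linear path
    of slope k. *)
Lemma path_increment (phi dphi : R -> C) (k : C) (M a b : R) :
  (forall t, rderiv phi t (dphi t)) ->
  (forall t, `|t - a| <= `|b - a| -> `|t - b| <= `|b - a| ->
     normc (dphi t - k) <= M) ->
  normc (phi b - phi a - (b - a)%:C * k) <= M * `|b - a|.
Proof.
move=> dp HM.
have lin t : rderiv (fun s => s%:C * k) t k.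
  move=> e e0; exists 1 => // h _.
  rewrite (_ : _ - _ - _ = 0); last by rewrite rmorphD; ring.
  by rewrite normc0 mulr_ge0// ltW.
rewrite (_ : _ - _ - _ = (phi b - b%:C * k) - (phi a - a%:C * k)).
  exact: (@mean_value_ineq R (fun t => phi t - t%:C * k) _ M a b
           (fun t => rderivB (dp t) (lin t)) HM).
by rewrite rmorphB; ring.
Qed.

Lemma ler_normc_rect (x y : R) : normc (x%:C + y%:C * 'i) <= `|x| + `|y|.
Proof.
rewrite (le_trans (le_normcD _ _))// normc_real normcM.
by rewrite normc_i mulr1 normc_real.
Qed.

(** Only integrals along horizontal and vertical lines occur: X y and Y x are
    primitives along the lines Im z = y and Re z = x, and I is the integral of
    f over the boundary of a rectangle.  Near p, f differs by o(|z - p|) from an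
    affine function, whose integral over a closed path is zero, so I vanishes
    by bisection.  Hence integrating f along the real axis and then vertically
    to z + h rather than to z adds an integral over a horizontal and a vertical
    segment near z, which is f(z) h + o(|h|) by continuity. *)
Lemma entire_primitive (f df : C -> C) : (forall z, cderiv f z (df z)) ->
  exists F : C -> C, forall z, cderiv F z (f z).
Proof.
move=> fd.
have fc z e : 0 < e -> exists2 d : R, 0 < d &
    forall w, normc (w - z) < d -> normc (f w - f z) <= e.
  exact: cderiv_continuous (fd z) e.
have Jex (zv : C * C) : exists J : R -> C,
    forall t, rderiv J t (zv.2 * f (zv.1 + t%:C * zv.2)).
  case: zv => z v /=; apply: path_primitive => t e e0.
  have N0 : 0 < normc v + 1 by rewrite ltr_wpDl ?normc_ge0.
  have [d d0 H] := fc (z + t%:C * v) _ (divr_gt0 e0 N0).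
  exists (d / (normc v + 1)) => [|s st]; first by rewrite divr_gt0.
  rewrite -mulrBr normcM.
  have := H (z + s%:C * v).
  rewrite (_ : _ + _ - _ = (s - t)%:C * v); last by rewrite rmorphB; ring.
  rewrite normcM normc_real.
  have sv : `|s - t| * normc v < d.
    apply: le_lt_trans (_ : `|s - t| * (normc v + 1) < d).
      by rewrite ler_wpM2l// lerDl.
    by rewrite -ltr_pdivlMr.
  move=> /(_ sv) /(ler_wpM2l (normc_ge0 v)) /le_trans; apply.
  by rewrite mulrA ler_pdivrMr// mulrC ler_wpM2l ?lerDl// ltW.
have [J HJ] := choice Jex.
pose X y := J (y%:C * 'i, 1); pose Y x := J (x%:C, 'i).
have dX y t : rderiv (X y) t (f (y%:C * 'i + t%:C)).
  by have := HJ (y%:C * 'i, 1) t; rewrite /= mul1r mulr1.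
have dY x t : rderiv (Y x) t ('i * f (x%:C + t%:C * 'i)) by exact: HJ.
pose I x0 x1 y0 y1 := (X y0 x1 - X y0 x0) + (Y x1 y1 - Y x1 y0)
  - (X y1 x1 - X y1 x0) - (Y x0 y1 - Y x0 y0).
have I0 : forall x0 x1 y0 y1, x0 <= x1 -> y0 <= y1 -> I x0 x1 y0 y1 = 0.
  apply: rectangle_bisection => [*|px py e e0]; first by rewrite /I; ring.
  set p := px%:C + py%:C * 'i.
  have [d d0 Hd] := fd p _ (divr_gt0 e0 (ltr0n R 2)).
  exists d => // x0 x1 y0 y1 /andP[x0p px1] /andP[y0p py1]; set s := _ + (_ - _) => sd.
  (* A primitive of the first-order Taylor polynomial of f at p. *)
  pose Q w := f p * w + df p / 2 * (w - p) ^+ 2.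
  have dQ w : cderiv Q w (f p + df p * (w - p)).
    apply: cderiv_eq (cderiv_quad (df p / 2 * p ^+ 2) (f p - df p * p) (df p / 2) w).
      by move=> u; rewrite /Q; field.
    by field.
  (* Within distance s of p, f and the derivative of Q differ by at most
     e / 2 * s; the mean value inequality turns this into a bound on a side. *)
  have side z v (G : R -> C) a b : normc v = 1 ->
      (forall t, rderiv G t (v * f (z + t%:C * v))) ->
      (forall t, `|t - a| <= `|b - a| -> `|t - b| <= `|b - a| ->
         normc (z + t%:C * v - p) <= s) ->
      normc ((G b - G a) - (Q (z + b%:C * v) - Q (z + a%:C * v))) <= e / 2 * s * `|b - a|.
    move=> v1 dG near.
    have -> : (G b - G a) - (Q (z + b%:C * v) - Q (z + a%:C * v))
      = (G b - Q (z + b%:C * v)) - (G a - Q (z + a%:C * v)) by ring.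
    apply: (@mean_value_ineq R (fun t => G t - Q (z + t%:C * v))
      (fun t => v * f (z + t%:C * v) - v * (f p + df p * (z + t%:C * v - p)))).
      by move=> t; apply: rderivB; [exact: dG|exact/cderiv_line/dQ].
    move=> t ta tb.
    rewrite -mulrBr normcM v1 mul1r.
    have nt := near _ ta tb.
    have := Hd _ (le_lt_trans nt sd); rewrite subrKC => Ht.
    rewrite opprD addrA [df p * _]mulrC (le_trans Ht)// ler_wpM2l//.
    by rewrite divr_ge0// ltW.
  have xabs a : x0 <= a <= x1 -> `|a - px| <= x1 - x0.
    by move=> /andP[? ?]; rewrite ler_norml; apply/andP; split; lra.
  have yabs a : y0 <= a <= y1 -> `|a - py| <= y1 - y0.
    by move=> /andP[? ?]; rewrite ler_norml; apply/andP; split; lra.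
  have s0 : 0 <= s by rewrite /s; lra.
  have bet (a b t : R) : `|t - a| <= b - a -> `|t - b| <= b - a -> a <= t <= b.
    by rewrite !ler_norml => /andP[? ?] /andP[? ?]; apply/andP; split; lra.
  have dist x y : x0 <= x <= x1 -> y0 <= y <= y1 -> normc (x%:C + y%:C * 'i - p) <= s.
    move=> hx hy; rewrite /p.
    rewrite (_ : _ - _ = (x - px)%:C + (y - py)%:C * 'i).
      by rewrite (le_trans (ler_normc_rect _ _))// lerD ?xabs ?yabs.
    by rewrite !rmorphB; ring.
  have lex : x0 <= x1 by lra.
  have ley : y0 <= y1 by lra.
  have lex' : 0 <= x1 - x0 by rewrite subr_ge0.
  have ley' : 0 <= y1 - y0 by rewrite subr_ge0.
  have sX y : y0 <= y <= y1 ->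
    normc ((X y x1 - X y x0) - (Q (x1%:C + y%:C * 'i) - Q (x0%:C + y%:C * 'i)))
      <= e / 2 * s * (x1 - x0).
    move=> hy; have := side (y%:C * 'i) 1 (X y) x0 x1 (normc1 _) (HJ _).
    rewrite !mulr1 (ger0_norm lex') ![y%:C * 'i + _]addrC; apply => t h1 h2.
    by rewrite mulr1 [y%:C * 'i + _]addrC dist// bet.
  have sY x : x0 <= x <= x1 ->
    normc ((Y x y1 - Y x y0) - (Q (x%:C + y1%:C * 'i) - Q (x%:C + y0%:C * 'i)))
      <= e / 2 * s * (y1 - y0).
    move=> hx; have := side x%:C 'i (Y x) y0 y1 (normc_i _) (HJ _).
    rewrite (ger0_norm ley'); apply => t h1 h2.
    by rewrite dist// bet.
  have hx0 : x0 <= x0 <= x1 by rewrite lexx.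
  have hx1 : x0 <= x1 <= x1 by rewrite lexx andbT.
  have hy0 : y0 <= y0 <= y1 by rewrite lexx.
  have hy1 : y0 <= y1 <= y1 by rewrite lexx andbT.
  have nB (u v : C) (a b : R) : normc u <= a -> normc v <= b -> normc (u - v) <= a + b.
    by move=> ua vb; rewrite (le_trans (le_normcD _ _))// normcN lerD.
  have nD (u v : C) (a b : R) : normc u <= a -> normc v <= b -> normc (u + v) <= a + b.
    by move=> ua vb; rewrite (le_trans (le_normcD _ _))// lerD.
  have := nB _ _ _ _ (nB _ _ _ _ (nD _ _ _ _ (sX y0 hy0) (sY x1 hx1)) (sX y1 hy1))
    (sY x0 hx0).
  rewrite (_ : _ - _ - _ = I x0 x1 y0 y1); last by rewrite /I; ring.
  move=> /le_trans; apply; rewrite le_eqVlt; apply/orP; left; apply/eqP.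
  by rewrite /s; field.
(* I is antisymmetric in each pair of bounds, so their order is immaterial. *)
have Iall x0 x1 y0 y1 : I x0 x1 y0 y1 = 0.
  have Ix a b c d : I a b c d = - I b a c d by rewrite /I; ring.
  have Iy a b c d : I a b c d = - I a b d c by rewrite /I; ring.
  case: (leP x0 x1) => [x01|/ltW x10]; case: (leP y0 y1) => [y01|/ltW y10].
  - exact: I0.
  - by rewrite Iy I0// oppr0.
  - by rewrite Ix I0// oppr0.
  - by rewrite Ix Iy I0// !oppr0.
(* The integral of f along the real axis up to Re z, then vertically to z. *)
exists (fun z => X 0 (complex.Re z) + Y (complex.Re z) (complex.Im z) - Y (complex.Re z) 0).
move=> z e e0.
have [d d0 Hd] := fc z _ (divr_gt0 e0 (ltr0n R 2)).
exists (d / 2) => [|h hd]; first by rewrite divr_gt0.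
case: z Hd => x y; case: h hd => a b hd Hd.
have zE : x +i* y = x%:C + y%:C * 'i by rewrite {1}[x +i* y]complexE /= mulrC.
have := Iall x (x + a) 0 y; rewrite /I /= => Ixa.
have hE : a +i* b = a%:C + b%:C * 'i by rewrite {1}[a +i* b]complexE /= mulrC.
have ha : `|a| <= normc (a +i* b) by exact: (ler_Re_normc (a +i* b)).
have hb : `|b| <= normc (a +i* b) by exact: (ler_Im_normc (a +i* b)).
have near (u v : R) : `|u| <= `|a| -> `|v| <= `|b| -> normc (u%:C + v%:C * 'i) < d.
  move=> ua vb; apply: le_lt_trans (ler_normc_rect _ _) _.
  by have := le_trans ua ha; have := le_trans vb hb; lra.
have stepx : normc (X y (x + a) - X y x - a%:C * f (x +i* y)) <= e / 2 * `|a|.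
  have := @path_increment (X y) _ (f (x +i* y)) (e / 2) x (x + a) (dX y).
  rewrite [x + a - x]addrC addKr; apply => t tx _; apply: Hd.
  rewrite zE (_ : _ - _ = (t - x)%:C + (0 : R)%:C * 'i).
    by rewrite near// normr0.
  by rewrite rmorphB rmorph0; ring.
have stepy : normc (Y (x + a) (y + b) - Y (x + a) y - b%:C * ('i * f (x +i* y)))
    <= e / 2 * `|b|.
  have := @path_increment (Y (x + a)) _ ('i * f (x +i* y)) (e / 2) y (y + b) (dY _).
  rewrite [y + b - y]addrC addKr; apply => t ty _.
  rewrite -mulrBr normcM normc_i mul1r; apply: Hd.
  rewrite zE (_ : _ - _ = a%:C + (t - y)%:C * 'i); first by rewrite near.
  by rewrite rmorphB rmorphD; ring.
rewrite (_ : _ - _ - _ = (X y (x + a) - X y x - a%:C * f (x +i* y)) +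
   (Y (x + a) (y + b) - Y (x + a) y - b%:C * ('i * f (x +i* y)))).
  rewrite (le_trans (le_normcD _ _))// (le_trans (lerD stepx stepy))//.
  rewrite [e in leRHS]splitr [leRHS]mulrDl.
  by apply: lerD; rewrite ler_wpM2l// divr_ge0// ltW.
rewrite /= [in (a +i* b) * _]hE.
apply/eqP; rewrite -subr_eq0 -Ixa; apply/eqP; ring.
Qed.
End EntirePrimitive.

(** * Cauchy's estimate *)

Section Cauchy.
Variable R : realType.
Local Notation C := R[i].

Definition cexp (z : C) : C :=
  (expR (complex.Re z))%:C * (cos (complex.Im z) +i* sin (complex.Im z)).

Lemma cexpD z w : cexp (z + w) = cexp z * cexp w.
Proof.
case: z w => [a b] [c d]; rewrite /cexp /= expRD cosD sinD rmorphM.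
by apply/eqP; rewrite eq_complex /=; apply/andP; split; apply/eqP; ring.
Qed.

Lemma normc_cexp z : normc (cexp z) = expR (complex.Re z).
Proof.
rewrite /cexp normcM normc_real ger0_norm ?expR_ge0//=.
by rewrite cos2Dsin2 sqrtr1 mulr1.
Qed.

Lemma cexp0 : cexp 0 = 1.
Proof.
by rewrite /cexp /= expR0 cos0 sin0 mul1r.
Qed.

Lemma cexpNK z : cexp (- z) * cexp z = 1.
Proof. by rewrite -cexpD addNr cexp0. Qed.

Definition two_pi_i : C := 0 +i* (pi *+ 2).

Lemma normc_two_pi_i : normc two_pi_i = pi *+ 2.
Proof. by rewrite /= expr0n add0r sqrtr_sqr ger0_norm// mulrn_wge0// pi_ge0. Qed.

Lemma cexp_periodic z : cexp (z + two_pi_i) = cexp z.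
Proof. by case: z => a b; rewrite /cexp /= addr0 cosD2pi sinD2pi. Qed.

Lemma cexpN_periodic z : cexp (- (z + two_pi_i)) = cexp (- z).
Proof. by rewrite -[LHS]cexp_periodic opprD subrK. Qed.

Lemma cexp_cderiv z : cderiv cexp z (cexp z).
Proof.
suff H e : 0 < e -> exists2 d : R, 0 < d &
    forall h : C, normc h < d -> normc (cexp h - 1 - h) <= e * normc h.
  move=> e e0; have E0 : 0 < expR (complex.Re z) by exact: expR_gt0.
  have [d d0 Hd] := H _ (divr_gt0 e0 E0); exists d => // h /Hd He.
  rewrite cexpD (_ : _ - _ - _ = cexp z * (cexp h - 1 - h)); last by ring.
  rewrite normcM normc_cexp.
  by rewrite (le_trans (ler_wpM2l (ltW E0) He))// mulrCA mulrA divfK ?gt_eqF.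
move=> e0.
(* With expR a = 1 + a + r, cos b = 1 + c and sin b = b + s, the error term
   cexp (a + i b) - 1 - (a + i b) is at most 9 k n once |r|, |c|, |s| <= k n
   and n = |a + i b| <= k <= 1. *)
have [k [k0 k1 ke]] : exists k : R, [/\ 0 < k, k <= 1 & 9 * k <= e].
  exists (Num.min 1 (e / 9)); rewrite lt_min ltr01 divr_gt0// ge_min lexx.
  by split=> //; rewrite mulrC -ler_pdivlMr// ge_min lexx orbT.
have [d1 d10 H1] := is_derive_increment (is_derive_expR 0) k0.
have [d2 d20 H2] := is_derive_increment (is_derive_cos 0) k0.
have [d3 d30 H3] := is_derive_increment (is_derive_sin 0) k0.
exists (Num.min k (Num.min d1 (Num.min d2 d3))) => [|[a b]].
  by rewrite !lt_min k0 d10 d20 d30.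
set n := normc _; rewrite !lt_min => /and4P[nk n1 n2 n3].
have an : `|a| <= n by exact: (ler_Re_normc (a +i* b)).
have bn : `|b| <= n by exact: (ler_Im_normc (a +i* b)).
have := H1 a (le_lt_trans an n1); rewrite add0r expR0 mulr1.
have := H2 b (le_lt_trans bn n2); rewrite add0r cos0 sin0 oppr0 mulr0 subr0.
have := H3 b (le_lt_trans bn n3); rewrite add0r cos0 sin0 subr0 mulr1.
set r := expR a - 1 - a; set c := cos b - 1; set s := sin b - b => Hs Hc Hr.
have -> : cexp (a +i* b) - 1 - (a +i* b) =
  r%:C + (c +i* s) + (a + r)%:C * ((0 +i* b) + (c +i* s)).
  rewrite /cexp /r /c /s.
  by apply/eqP; rewrite eq_complex /=; apply/andP; split; apply/eqP; ring.
have Hcs : normc (c +i* s) <= 2 * k * n.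
  apply: le_trans (ler_normc_ReIm _) _ => /=.
  have := le_trans Hs (ler_wpM2l (ltW k0) bn); have := le_trans Hc (ler_wpM2l (ltW k0) bn).
  lra.
have n0 : 0 <= n by exact: normc_ge0.
have Hr' : `|r| <= k * n by exact: le_trans Hr (ler_wpM2l (ltW k0) an).
have kn : k * n <= n by rewrite ler_piMl.
have Har : normc (a + r)%:C <= 2 * k.
  rewrite normc_real (le_trans (ler_normD _ _))//; lra.
have Hbc : normc ((0 +i* b) + (c +i* s)) <= 3 * n.
  rewrite (le_trans (le_normcD _ _))//.
  have -> : normc (0 +i* b) = `|b| by rewrite /= expr0n add0r sqrtr_sqr.
  lra.
rewrite (le_trans (le_normcD _ _))// normcM.
apply: (le_trans (y := (k * n + 2 * k * n) + (2 * k) * (3 * n))).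
  apply: lerD.
    by rewrite (le_trans (le_normcD _ _))// normc_real lerD.
  by apply: ler_pM => //; exact: normc_ge0.
have := ler_wpM2r n0 ke; lra.
Qed.

(** In the coordinate z = e^w, the integral of f(z) / z^2 over a circle becomes
    the increment D w of a primitive of f(e^w) e^-w along a period of exp.  It
    is constant in w; it is evaluated as Re w tends to -oo and estimated at
    |z| = rho. *)
Lemma cauchy_estimate0 (f df : C -> C) (rho M : R) :
  (forall z, cderiv f z (df z)) -> 0 < rho ->
  (forall z, normc z <= rho -> normc (f z) <= M) -> normc (df 0) <= M / rho.
Proof.
move=> fd rho0 fM.
have dexpN w : cderiv (fun w => cexp (- w)) w (- cexp (- w)).
  apply: cderiv_eq (cderiv_comp (cderiv_quad 0 (-1) 0 w) (cexp_cderiv _)).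
    by move=> u /=; congr cexp; ring.
  rewrite (_ : 0 + -1 * w + 0 * w ^+ 2 = - w); last by ring.
  by ring.
pose K w := f (cexp w) * cexp (- w).
have [H dH0] := entire_primitive
  (fun w => cderivM (cderiv_comp (cexp_cderiv w) (fd _)) (dexpN w)).
have dH w : cderiv H w (K w) by exact: dH0.
have Kper w : K (w + two_pi_i) = K w.
  by rewrite /K cexp_periodic cexpN_periodic.
pose tau := two_pi_i.
have tau0 : 0 < normc tau by rewrite normc_two_pi_i mulrn_wgt0// pi_gt0.
pose D w := H (w + tau) - H w.
have Dcst w : D w = D 0.
  have dD u : cderiv D u 0.
    apply: cderiv_eq (cderivB (cderiv_shift (dH (u + tau))) (dH u)) => //.
    by rewrite Kper subrr.
  apply/eqP; rewrite -subr_eq0 -normc_eq0 eq_le normc_ge0 andbT.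
  have := @cmean_value R D (fun _ => 0) 0 w 0 dD; rewrite add0r mul0r; apply.
  by move=> t _; rewrite normc0.
have ReN (z : C) : complex.Re (- z) = - complex.Re z by case: z.
have reline (x t : R) : complex.Re (x%:C + t%:C * tau) = x by rewrite /=; ring.
have bound : normc (D 0) <= M / rho * normc tau.
  rewrite -(Dcst (ln rho)%:C); apply: (cmean_value dH) => t _.
  rewrite normcM normc_cexp ReN reline expRN lnK ?posrE//.
  rewrite ler_wpM2r ?invr_ge0 ?(ltW rho0)//; apply: fM.
  by rewrite normc_cexp reline lnK ?posrE.
rewrite -(ler_pM2r tau0); apply/ler_addgt0Pr => e e0.
have [d d0 Hd] := fd 0 _ (divr_gt0 e0 tau0).
have d2 : 0 < d / 2 by rewrite divr_gt0.
pose x := ln (d / 2).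
(* Removing f 0 * e^-w, whose primitive is periodic, and the limit df 0 leaves
   an integrand that is small for Re w = x. *)
pose G w := H w + (f 0 * cexp (- w) + - (df 0 * w)).
have dG w : cderiv G w (K w - f 0 * cexp (- w) - df 0).
  have did : cderiv id w 1.
    apply: cderiv_eq (cderiv_quad 0 1 0 w); last by ring.
    by move=> u /=; ring.
  apply: cderiv_eq (cderivB (cderivB (dH w) (cderivZ (- f 0) (dexpN w)))
    (cderivZ (df 0) did)).
    by move=> u; rewrite /G; ring.
  by ring.
have := @cmean_value R G _ x%:C tau (e / normc tau) dG.
have -> : G (x%:C + tau) - G x%:C = D 0 - df 0 * tau.
  rewrite -(Dcst x%:C) /G /D.
  have -> : cexp (- (x%:C + tau)) = cexp (- x%:C).
    by rewrite cexpN_periodic.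
  by ring.
rewrite divfK ?gt_eqF// => HG.
rewrite -normcM -(subrK (D 0) (df 0 * tau)).
rewrite (le_trans (le_normcD _ _))// addrC lerD// normcB; apply: HG => t _.
set w := x%:C + _; have rew : complex.Re w = x by rewrite reline.
have -> : K w - f 0 * cexp (- w) - df 0 =
    (f (0 + cexp w) - f 0 - cexp w * df 0) * cexp (- w).
  by rewrite add0r -[df 0 in LHS]mulr1 -(cexpNK w) /K; ring.
have ew : normc (cexp w) = d / 2 by rewrite normc_cexp rew lnK// posrE.
rewrite normcM.
have := Hd (cexp w); rewrite ew ltr_pdivrMr// ltr_pMr// ltr1n => /(_ isT) Hw.
have -> : normc (cexp (- w)) = (d / 2)^-1.
  by rewrite normc_cexp ReN rew expRN lnK// posrE.
by rewrite ler_pdivrMr.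
Qed.

Lemma cauchy_estimate (f df : C -> C) z (rho M : R) :
  (forall w, cderiv f w (df w)) -> 0 < rho ->
  (forall w, normc w <= rho -> normc (f (z + w)) <= M) -> normc (df z) <= M / rho.
Proof.
move=> fd rho0 fM.
have := @cauchy_estimate0 (fun w => f (z + w)) (fun w => df (z + w)) rho M.
rewrite addr0; apply => // w; apply: cderiv_eq (cderiv_shift (fd (w + z))).
  by move=> u; rewrite addrC.
by rewrite addrC.
Qed.

Section SecondOrder.
Variables (u du : C -> C) (M : R).
Hypothesis ud : forall t, cderiv u t (du t).
Hypothesis uM : forall t, normc t <= 2 -> normc (u t) <= M.

Lemma increment_bound s t : normc s <= 1 -> normc t <= 1 ->
  (forall r : R, 0 <= r <= 1 -> normc (t + r%:C * s) <= 1) ->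
  normc (u (t + s) - u t) <= M * normc s.
Proof.
move=> s1 t1 ts; apply: (cmean_value ud) => r r01.
rewrite -[M]divr1; apply: (cauchy_estimate ud) => // w w1.
apply: uM; rewrite (le_trans (le_normcD _ _))//.
have := ts _ r01; lra.
Qed.

(** Without knowing that du is differentiable, Cauchy's estimate applied to
    u (t + h) - u t shows that du is Lipschitz at 0; integrate this. *)
Lemma taylor2_bound s : normc s <= 1 / 2 ->
  normc (u s - u 0 - s * du 0) <= 2 * M * normc s ^+ 2.
Proof.
move=> s2.
have M0 : 0 <= M.
  by apply: le_trans (uM (t := 0) _); rewrite ?normc_ge0// normc0.
have rs (r : R) h : 0 <= r <= 1 -> normc (r%:C * h) <= normc h.
  move=> /andP[r0 r1]; rewrite normcM normc_real ger0_norm//.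
  by rewrite ler_piMl// normc_ge0.
have dul h : normc h <= 1 / 2 -> normc (du h - du 0) <= 2 * M * normc h.
  move=> h2.
  have := @cauchy_estimate (fun t => u (t + h) - u t)
    (fun t => du (t + h) - du t) 0 (1 / 2) (M * normc h).
  rewrite add0r (_ : _ / (1 / 2) = 2 * M * normc h); last by field.
  apply => [w||w w2]; first exact: cderivB (cderiv_shift _) _.
  - by rewrite divr_gt0.
  - rewrite add0r increment_bound//; try lra.
    by move=> r /(rs r h) rh; rewrite (le_trans (le_normcD _ _))//; lra.
have dv t : cderiv (fun t => u t + - (du 0 * t)) t (du t - du 0).
  apply: cderivD (ud t) _; apply: cderiv_eq (cderiv_quad 0 (- du 0) 0 t); last by ring.
  by move=> v /=; ring.
have := @cmean_value R _ _ 0 s (2 * M * normc s) dv.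
rewrite add0r (_ : _ - _ = u s - u 0 - s * du 0); last by ring.
move=> H; rewrite expr2 mulrA; apply: H => t t01; rewrite add0r.
have ts := rs t s t01; apply: le_trans (dul _ (le_trans ts s2)) _.
by rewrite ler_wpM2l// mulr_ge0.
Qed.

End SecondOrder.
End Cauchy.

(** * Polydiscs and differentiability in several variables *)

Section Polydiscs.
Variables (R : realType) (d : nat).
Local Notation C := R[i].
Local Notation Cd := 'rV[C]_d.

Lemma gt0_complexP (x : C) : 0 < x -> exists2 e : R, 0 < e & x = e%:C.
Proof.
by case: x => a b; rewrite ltcE/= => /andP[/eqP b0 a0]; exists a => //; rewrite b0.
Qed.

Lemma normc_continuous : continuous (@normc R).
Proof.
move=> z; apply/(@cvgrPdist_le _ _ _ (nbhs z)) => e e0.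
exists e%:C => /=; first by rewrite ltcR.
move=> w; rewrite /= normc_lt => zw.
have h1 := le_normcD (z - w) w; have h2 := le_normcD (w - z) z.
move: h1 h2; rewrite !subrK (normcB w) => h1 h2.
by rewrite ler_norml; apply/andP; split; lra.
Qed.

(** A closed subset of the image of a square under (x, y) |-> x + i y. *)
Lemma compact_disc (r : R) : compact [set z : C | normc z <= r].
Proof.
pose S := [set p : R * R | `[- r, r]%classic p.1 /\ `[- r, r]%classic p.2].
pose j (p : R * R) : C := p.1 +i* p.2.
have cj : continuous j.
  move=> p; apply/cvgrPdist_lt => x /gt0_complexP[e e0 ->].
  exists (ball p.1 (e / 2), ball p.2 (e / 2)) => /=.
    by split; apply: nbhsx_ballx; rewrite divr_gt0.
  move=> q [/= h1 h2]; rewrite normc_lt /j.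
  have -> : (p.1 +i* p.2) - (q.1 +i* q.2) = (p.1 - q.1) +i* (p.2 - q.2) by [].
  apply: le_lt_trans (ler_normc_ReIm _) _.
  by rewrite [e]splitr ltrD.
apply: (@subclosed_compact _ _ (j @` S)).
- rewrite (_ : mkset _ = (@normc R) @^-1` [set x | x <= r]) //.
  by apply: preimage_closed; [move=> z _; exact: normc_continuous|exact: closed_le].
- apply: continuous_compact; first exact: continuous_subspaceT.
  by apply: compact_setX; exact: segment_compact.
- move=> z zr; exists (complex.Re z, complex.Im z); last by case: (z).
  by split; rewrite /= in_itv/= -ler_norml (le_trans _ zr)// ?ler_Re_normc ?ler_Im_normc.
Qed.

Definition polydisc (r : R) : set Cd := [set z | forall i, normc (z 0 i) <= r].

Lemma compact_polydisc r : compact (polydisc r).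
Proof. exact: (@rV_compact C d (fun _ => _) (fun _ => @compact_disc r)). Qed.

Lemma polydisc_le r s : r <= s -> polydisc r `<=` polydisc s.
Proof. by move=> rs z zr i; exact: le_trans rs. Qed.

Lemma polydiscD r s z w : polydisc r z -> polydisc s w -> polydisc (r + s) (z + w).
Proof.
by move=> zr ws i; rewrite mxE (le_trans (le_normcD _ _))// lerD.
Qed.

Lemma polydiscZ r (a : C) z : polydisc r z -> polydisc (normc a * r) (a *: z).
Proof.
by move=> zr i; rewrite mxE normcM ler_wpM2l ?normc_ge0.
Qed.

Lemma in_polydisc z : exists2 r, 0 <= r & polydisc r z.
Proof.
exists (\sum_i normc (z 0 i)); first by rewrite sumr_ge0// => i _; exact: normc_ge0.
by move=> i; rewrite (bigD1 i)//= lerDl sumr_ge0// => j _; exact: normc_ge0.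
Qed.

Lemma differentiable_cont (f : Cd -> C) :
  (forall z, differentiable f z) -> continuous f.
Proof. by move=> df z; exact: differentiable_continuous. Qed.

Lemma bounded_on_compact (f : Cd -> C) K : continuous f -> compact K ->
  exists2 M : R, 0 < M & forall z, K z -> normc (f z) <= M.
Proof.
move=> cf cK; have [->|/set0P K0] := eqVneq K set0; first by exists 1.
have [|c cK' H] := @compact_EVT_max _ R (@normc R \o f) K K0 cK.
  apply: continuous_subspaceT => z; apply: continuous_comp; first exact: cf.
  exact: normc_continuous.
exists (normc (f c) + 1) => [|z /mem_set /H /= zc]; first by rewrite ltr_wpDl ?normc_ge0.
by rewrite (le_trans zc)// lerDl.
Qed.

Lemma compact_sub_polydisc (K : set Cd) : compact K ->
  exists2 r, 0 < r & K `<=` polydisc r.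
Proof.
move=> cK.
have coord i : exists M : R, 0 < M /\ forall z, K z -> normc (z 0 i) <= M.
  have [|M M0 H] := @bounded_on_compact (fun z : Cd => z 0 i) K _ cK; last by exists M.
  exact: coord_continuous.
have [M HM] := choice coord.
exists (1 + \sum_i M i).
  by rewrite ltr_wpDr// sumr_ge0// => i _; rewrite ltW; have [] := HM i.
move=> z Kz i; have [_ H] := HM i; rewrite (le_trans (H _ Kz))//.
rewrite (bigD1 i)//= addrCA lerDl addr_ge0// sumr_ge0// => j _.
by rewrite ltW; have [] := HM j.
Qed.

Lemma coord_le_norm (h : Cd) i : normc (h 0 i) <= complex.Re `|h|.
Proof.
have : `|h 0 i| <= `|h|.
  have -> : `|h| = mx_norm h by [].
  by rewrite mx_normE -[leLHS]nngE num_le; exact: (le_bigmax _ _ (0, i)).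
by rewrite normcE lecE /= => /andP[].
Qed.

(** The linear form sum_j h_j a_j is itself differentiable; once it is
    subtracted, the zero map is the differential of what remains. *)
Lemma differentiable_quadratic (g : Cd -> C) z (a : 'I_d -> C) (K e : R) : 0 < e ->
  (forall s h, 0 <= s <= e -> polydisc s h ->
    normc (g (z + h) - g z - \sum_j h 0 j * a j) <= K * s ^+ 2) ->
  differentiable g z.
Proof.
move=> e0 H.
pose l (w : Cd) := \sum_j a j * w 0 j.
have dl w : differentiable l w.
  rewrite /l (_ : (fun _ => _) = \sum_j (fun w : Cd => a j * w 0 j)); last first.
    by apply/funext => u; rewrite fct_sumE.
  apply: differentiable_sum => j.
  have := @differentiableZ _ _ _ (fun w : Cd => w 0 j) (a j) w.
  by apply; exact: differentiable_coord.
have -> : g = (fun w => g w - l w) + l by apply/funext => w; rewrite /= subrK.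
apply: differentiableD (dl z).
set k := fun w => _.
have kE h : k (z + h) - k z = g (z + h) - g z - \sum_j h 0 j * a j.
  have lD : l (z + h) = l z + \sum_j h 0 j * a j.
    rewrite /l -big_split; apply: eq_bigr => j _.
    by rewrite /= mxE mulrDr [h 0 j * _]mulrC.
  by rewrite /k lD; ring.
have little : k = (fun w => k z + (\0 : {linear Cd -> C}) (w - z)) +o_ z (fun w => w - z).
  apply/eqaddoP => x /gt0_complexP[c c0 ->].
  have K0 : 0 < `|K| + 1 by rewrite ltr_wpDl.
  have m0 : 0 < (Num.min e (c / (`|K| + 1)))%:C by rewrite ltcR lt_min e0 divr_gt0.
  apply: (@filterS _ (nbhs z) _ _ _ _ (nbhsx_ballx z _ m0)) => w.
  rewrite -ball_normE /= distrC; set h := w - z => hw.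
  have [n n0 nE] : exists2 n : R, 0 <= n & `|h| = n%:C.
    exists (complex.Re `|h|); first by have := normr_ge0 h; rewrite lecE /= => /andP[].
    by have := normr_ge0 h; rewrite lecE /=; case: (`|h|) => p q /= /andP[/eqP -> _].
  move: hw; rewrite nE ltcR lt_min => /andP[ne nc].
  have wE : w = z + h by rewrite /h subrKC.
  have := H n h; rewrite n0 (ltW ne) => /(_ isT) Hn.
  have {}Hn : normc (k w - k z) <= K * n ^+ 2.
    rewrite wE kE; apply: Hn => i; have := coord_le_norm h i.
    by rewrite nE.
  have -> : (k - (fun u => k z + (\0 : {linear Cd -> C}) (u - z))) w = k w - k z.
    by rewrite -[LHS]/(k w - (k z + 0)) addr0.
  rewrite -rmorphM normc_le; apply: le_trans Hn _.
  rewrite expr2 mulrA ler_wpM2r//.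
  apply: (le_trans (y := (`|K| + 1) * n)).
    by rewrite ler_wpM2r// (le_trans (ler_norm _))// lerDl.
  by rewrite mulrC -ler_pdivlMr// ltW.
have ex : exists df : {linear Cd -> C}, continuous df /\
    forall x, k x = k (lim (nbhs z)) + df (x - lim (nbhs z))
      +o_(x \near z) (x - lim (nbhs z)).
  exists \0; split; first by move=> x; exact: cst_continuous.
  by rewrite !lim_id // => x; exact: (congr1 (@^~ x) little).
apply/diffP; have H1 := getPex ex.
exact: H1.
Qed.
End Polydiscs.

(** * Directional and mixed derivatives *)

Section Lines.
Variables (R : realType) (d : nat).
Local Notation C := R[i].
Local Notation Cd := 'rV[C]_d.
Implicit Types (f g : Cd -> C) (z v h : Cd).

Lemma cderiv_along f z v t : differentiable f (z + t *: v) ->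
  cderiv (fun s => f (z + s *: v)) t ('D_v f (z + t *: v)).
Proof.
move=> fd; set x := z + t *: v in fd *.
have /(@diff_derivable _ _ _ _ _ v) /cvg_ex [l Hl] := fd.
have -> : 'D_v f x = l by exact/cvg_lim.
move=> e e0.
have e0C : 0 < e%:C by rewrite ltcR.
move: Hl => /cvgrPdist_le /(_ _ e0C); rewrite near_withinE.
move=> -[x0 /gt0_complexP [del del0 ->] H].
exists del => // k kd; have [->|k0] := eqVneq k 0.
  by rewrite addr0 mul0r !subrr normc0 mulr0.
have := H k; rewrite /= sub0r normrN normc_lt => /(_ kd k0).
rewrite normc_le => Hk.
have -> : z + (t + k) *: v = k *: v + x by rewrite scalerDl addrA addrC.
rewrite (_ : _ - _ - _ = - (l - k^-1 *: (f (k *: v + x) - f x)) * k).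
  rewrite normcM normcN ler_wpM2r ?normc_ge0//.
by rewrite /GRing.scale/=; field.
Qed.

Lemma derive_linear f z h : differentiable f z ->
  'D_h f z = \sum_j h 0 j * 'D_(delta_mx 0 j) f z.
Proof.
move=> fd; rewrite deriveE// {1}[h]row_sum_delta linear_sum; apply: eq_bigr => j _.
by rewrite linearZ /= deriveE.
Qed.

Lemma derive_bound f z v (rho M : R) : (forall w, differentiable f w) -> 0 < rho ->
  (forall t : C, normc t <= rho -> normc (f (z + t *: v)) <= M) ->
  normc ('D_v f z) <= M / rho.
Proof.
move=> fd rho0 H.
have := @cauchy_estimate R (fun t => f (z + t *: v)) _ 0 rho M
  (fun t => cderiv_along (fd _)) rho0.
rewrite scale0r addr0; apply => w wr; rewrite add0r; exact: H.
Qed.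

Lemma cderiv_unique (g : C -> C) t c c' : cderiv g t c -> cderiv g t c' -> c = c'.
Proof.
move=> gc gc'; apply/eqP; rewrite -subr_eq0 -normc_eq0 eq_le normc_ge0 andbT.
apply/ler_addgt0Pr => e e0; rewrite add0r.
have e20 : 0 < e / 2 by rewrite divr_gt0.
have [a a0 H] := gc _ e20; have [b b0 H'] := gc' _ e20.
have [m [m0 ma mb]] : exists m : R, [/\ 0 < m, m < a & m < b].
  exists (Num.min (a / 2) (b / 2)); rewrite lt_min !gt_min !divr_gt0//.
  by split=> //; apply/orP; [left|right]; lra.
have nm : normc m%:C = m by rewrite normc_real ger0_norm// ltW.
have := H m%:C; have := H' m%:C; rewrite nm => /(_ mb) h' /(_ ma) h.
rewrite -(ler_pM2l m0) -{1}nm -normcM.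
rewrite (_ : _ * _ = (g (t + m%:C) - g t - m%:C * c') - (g (t + m%:C) - g t - m%:C * c)).
  rewrite (le_trans (le_normcD _ _))// normcN (le_trans (lerD h' h))//; lra.
by ring.
Qed.

Lemma cderiv_sum (n : nat) (g : 'I_n -> C -> C) (a c : 'I_n -> C) t :
  (forall j, cderiv (g j) t (c j)) ->
  cderiv (fun s => \sum_j a j * g j s) t (\sum_j a j * c j).
Proof.
move=> gc; rewrite -[index_enum _]/(index_enum 'I_n).
elim: (index_enum _) => [|j r IH].
  apply: cderiv_eq (cderiv_quad 0 0 0 t); last by rewrite big_nil; ring.
  by move=> s /=; rewrite big_nil; ring.
apply: cderiv_eq (cderivD (cderivM (cderiv_quad (a j) 0 0 t) (gc j)) IH).
  by move=> s /=; rewrite big_cons; ring.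
by rewrite big_cons; ring.
Qed.

(** The intervals of radii k i around the x i intersect pairwise, hence have a
    common point: the supremum of their left endpoints. *)
Lemma real_center (I : Type) (i0 : I) (x k : I -> R) :
  (forall i j, `|x i - x j| <= k i + k j) ->
  exists l, forall i, `|x i - l| <= k i.
Proof.
move=> H; pose A := range (fun i => x i - k i).
have ub i j : x i - k i <= x j + k j.
  by have := le_trans (ler_norm _) (H i j); lra.
exists (sup A) => i; rewrite ler_norml; apply/andP; split.
  suff : sup A <= x i + k i by lra.
  by apply: ge_sup; [exists (x i0 - k i0), i0|move=> _ [j _ <-]].
suff : x i - k i <= sup A by lra.
by apply: ub_le_sup; [exists (x i0 + k i0) => _ [j _ <-]|exists i].
Qed.

(** Completeness of C in the form used for difference quotients: where k tends
    to 0, the values q tend to l, at the rate k. *)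
Lemma complex_center (I : Type) (i0 : I) (q : I -> C) (k : I -> R) :
  (forall i j, normc (q i - q j) <= k i + k j) ->
  exists l, forall i, normc (q i - l) <= 2 * k i.
Proof.
move=> H.
have [|a Ha] := @real_center I i0 (fun i => complex.Re (q i)) k.
  move=> i j; apply: le_trans (H i j); apply: le_trans (ler_Re_normc _).
  by case: (q i) (q j) => ? ? [].
have [|b Hb] := @real_center I i0 (fun i => complex.Im (q i)) k.
  move=> i j; apply: le_trans (H i j); apply: le_trans (ler_Im_normc _).
  by case: (q i) (q j) => ? ? [].
exists (a +i* b) => i; apply: le_trans (ler_normc_ReIm _) _.
have := Ha i; have := Hb i; case: (q i) => u v /=; lra.
Qed.

(** The quotient G t s of increments in t tends to dt s 0, uniformly in s, with
    error O(|t|) by Taylor's formula in t.  Cauchy's estimate in s transfers this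
    to the s-derivatives q t of G t at 0, which therefore converge to some l;
    this is the first remainder.  The second one is the limit as t -> 0 of
    Taylor's formula in s for G t. *)
Lemma mixed_derivative (F ds dt : C -> C -> C) (M : R) :
  (forall s t, cderiv (F ^~ t) s (ds s t)) ->
  (forall s t, cderiv (F s) t (dt s t)) ->
  (forall s t, normc s <= 2 -> normc t <= 2 -> normc (F s t) <= M) ->
  exists l,
    (forall t, normc t <= 1 / 2 ->
       normc (ds 0 t - ds 0 0 - t * l) <= 4 * M * normc t ^+ 2) /\
    (forall s, normc s <= 1 / 2 ->
       normc (dt s 0 - dt 0 0 - s * l) <= 2 * M * normc s ^+ 2).
Proof.
move=> dF dF' FM.
have n0 : normc (0 : C) = 0 by exact: normc0.
have M0 : 0 <= M by apply: le_trans (FM 0 0 _ _); rewrite ?normc_ge0 ?n0.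
pose I := {t : C | t != 0 /\ normc t <= 1 / 2}.
pose G (t s : C) := t^-1 * (F s t - F s 0).
pose q t := t^-1 * (ds 0 t - ds 0 0).
have dG t s : cderiv (G t) s (t^-1 * (ds s t - ds s 0)).
  exact: cderivZ (cderivB (dF s t) (dF s 0)).
have Gdt t s : t != 0 -> normc t <= 1 / 2 -> normc s <= 2 ->
    normc (G t s - dt s 0) <= 2 * M * normc t.
  move=> t0 t2 s2.
  have := taylor2_bound (dF' s) (fun t => FM s t s2) t2.
  rewrite (_ : _ - _ - _ = t * (G t s - dt s 0)); last by rewrite /G; field.
  rewrite normcM expr2 !mulrA [normc t * _]mulrC ler_pM2r//.
  by rewrite normc_gt0.
have GM t s : t != 0 -> normc t <= 1 / 2 -> normc s <= 2 -> normc (G t s) <= M.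
  move=> t0 t2 s2; have tp : 0 < normc t by rewrite normc_gt0.
  rewrite /G normcM normcV ler_pdivrMl// mulrC.
  have := @increment_bound _ (F s) _ M (dF' s) (fun t => FM s t s2) t 0.
  rewrite add0r; apply; rewrite ?n0//; first by lra.
  move=> r /andP[r0 r1]; rewrite add0r normcM normc_real ger0_norm//.
  by have := ler_wpM2r (ltW tp) r1; lra.
have half : (1 / 2 : R)%:C != 0.
  by rewrite -normc_gt0 normc_real normr_gt0 lt0r_neq0// divr_gt0.
have nhalf : normc (1 / 2 : R)%:C <= 1 / 2.
  by rewrite normc_real ger0_norm// divr_ge0.
have [|l Hl] := @complex_center I (exist _ _ (conj half nhalf)) (fun t => q (sval t))
    (fun t => 2 * M * normc (sval t)).
  move=> [t [t0 t2]] [t' [t'0 t'2]] /=.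
  have := @cauchy_estimate R (fun s => G t s - G t' s) _ 0 1
    (2 * M * normc t + 2 * M * normc t') (fun s => cderivB (dG t s) (dG t' s)) ltr01.
  rewrite divr1 -!/(q _); apply => s s1; rewrite add0r.
  have s2 : normc s <= 2 by lra.
  rewrite (_ : _ - _ = (G t s - dt s 0) - (G t' s - dt s 0)); last by ring.
  by rewrite (le_trans (le_normcD _ _))// normcN lerD ?Gdt.
exists l; split=> [t t2|s s2].
  have [->|t0] := eqVneq t 0; first by rewrite subrr mul0r subrr n0 expr0n mulr0.
  have /= := Hl (exist _ t (conj t0 t2)) => /(ler_wpM2l (normc_ge0 t)).
  rewrite -normcM (_ : t * _ = ds 0 t - ds 0 0 - t * l); last by rewrite /q; field.
  by move=> /le_trans; apply; rewrite expr2; lra.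
(* For |t| = r, replacing G t by its limit costs at most 6 M r <= e. *)
apply/ler_addgt0Pr => e e0.
have N0 : 0 < 6 * M + 1 by lra.
pose r := Num.min (1 / 2) (e / (6 * M + 1)).
have r0 : 0 < r by rewrite lt_min !divr_gt0.
have rn : normc r%:C = r by rewrite normc_real ger0_norm// ltW.
have tn0 : r%:C != 0 by rewrite -normc_gt0 rn.
have r2 : normc r%:C <= 1 / 2 by rewrite rn ge_min lexx.
have re : 6 * M * r <= e.
  have : r * (6 * M + 1) <= e by rewrite -ler_pdivlMr// ge_min lexx orbT.
  lra.
have h1 := Gdt _ s tn0 r2 (le_trans s2 (_ : 1 / 2 <= 2)).
have h2 := Gdt _ 0 tn0 r2.
have h3 : normc (q r%:C - l) <= 2 * (2 * M * normc r%:C).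
  exact: (Hl (exist _ _ (conj tn0 r2))).
have h4 := taylor2_bound (dG r%:C) (fun s => GM _ s tn0 r2) s2.
move: h1 h2 h3 h4; rewrite n0 rn -/(q _).
move=> /(_ ltac:(lra)) h1 /(_ ltac:(lra)) h2 h3 h4.
rewrite (_ : _ - _ - _ = (G r%:C s - G r%:C 0 - s * q r%:C) - (G r%:C s - dt s 0)
   + (G r%:C 0 - dt 0 0) + s * (q r%:C - l)); last by ring.
rewrite (le_trans (le_normcD _ _))// normcM.
have h5 := ler_pM (normc_ge0 s) (normc_ge0 _) s2 h3.
apply: le_trans (lerD (le_trans (le_normcD _ _) (lerD (le_trans (le_normcD _ _)
  (lerD h4 (_ : normc (- _) <= _))) h2)) h5) _; first by rewrite normcN; exact: h1.
lra.
Qed.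
End Lines.

(** * Derivatives of entire functions are entire *)

Section DerivativesAreEntire.
Variables (R : realType) (d : nat).
Local Notation C := R[i].
Local Notation Cd := 'rV[C]_d.
Variable f : Cd -> C.
Hypothesis fd : forall z, differentiable f z.

(** One bound for the two-parameter families of translates used below, uniform
    in the base point and in both directions. *)
Lemma bounded_near (r b c : R) : exists2 M : R, 0 < M & forall z h v,
  polydisc r z -> polydisc b h -> polydisc c v ->
  forall s t : C, normc s <= 2 -> normc t <= 2 ->
  normc (f (z + s *: h + t *: v)) <= M.
Proof.
have [M M0 H] := bounded_on_compact (differentiable_cont fd)
  (@compact_polydisc R d (r + 2 * `|b| + 2 * `|c|)).
exists M => // z h v zr hb vc s t s2 t2; apply: H.
have scl (a : C) x w : normc a <= 2 -> polydisc x w -> polydisc (2 * `|x|) (a *: w).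
  move=> a2 wx; apply: polydisc_le (polydiscZ a (polydisc_le (ler_norm x) wx)).
  by rewrite ler_wpM2r.
by apply: polydiscD; [apply: polydiscD|]; [|exact: scl..].
Qed.

Lemma mixed_along z v h M :
  (forall s t : C, normc s <= 2 -> normc t <= 2 ->
     normc (f (z + s *: h + t *: v)) <= M) ->
  exists l,
    (forall t : C, normc t <= 1 / 2 ->
       normc ('D_h f (z + t *: v) - 'D_h f z - t * l) <= 4 * M * normc t ^+ 2) /\
    (forall s : C, normc s <= 1 / 2 ->
       normc ('D_v f (z + s *: h) - 'D_v f z - s * l) <= 2 * M * normc s ^+ 2).
Proof.
move=> fM.
have [s t|s t||l [Hl Hl']] := @mixed_derivative R (fun s t => f (z + s *: h + t *: v))
  (fun s t => 'D_h f (z + s *: h + t *: v)) (fun s t => 'D_v f (z + s *: h + t *: v)) M.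
- rewrite addrAC; apply: cderiv_eq (cderiv_along (fd (z + t *: v + s *: h))) => // u.
  by rewrite addrAC.
- exact: cderiv_along.
- exact: fM.
exists l; split=> [t t2|s s2].
  by have := Hl t t2; rewrite !scale0r !addr0.
by have := Hl' s s2; rewrite !scale0r !addr0.
Qed.

(** The remainders in [mixed_along] are uniform over directions h in the unit
    polydisc.  The mixed derivative l_h is linear in h because 'D_h f is, so
    its values l j on the basis vectors form the candidate differential of
    'D_v f. *)
Lemma derive_differentiable v z : differentiable ('D_v f) z.
Proof.
have [b b0 vb] := in_polydisc v; have [r r0 zr] := in_polydisc z.
have [M M0 fM] := bounded_near r 1 b.
have mix h : polydisc 1 h -> exists l, cderiv (fun t => 'D_h f (z + t *: v)) 0 l /\
    (forall s : C, normc s <= 1 / 2 ->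
       normc ('D_v f (z + s *: h) - 'D_v f z - s * l) <= 2 * M * normc s ^+ 2).
  move=> h1; have [l [Hl Hl']] := mixed_along (fM z h v zr h1 vb).
  exists l; split=> //; apply: cderiv_quadratic => t t2.
  rewrite add0r scale0r addr0; exact: Hl.
have e1 j : polydisc 1 (delta_mx 0 j : Cd).
  move=> i; rewrite mxE eqxx /=; case: (i == j); rewrite ?normc1//.
  by rewrite normc0.
have [l Hl] := choice (fun j => mix _ (e1 j)).
have lin h : polydisc 1 h -> forall s : C, normc s <= 1 / 2 ->
    normc ('D_v f (z + s *: h) - 'D_v f z - s * \sum_j h 0 j * l j)
      <= 2 * M * normc s ^+ 2.
  move=> h1; have [k [Hk Hk']] := mix _ h1.
  suff -> : \sum_j h 0 j * l j = k by [].
  apply: cderiv_unique Hk; apply: cderiv_eq (cderiv_sum _ (fun j => (Hl j).1)) => //.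
  by move=> t; rewrite derive_linear.
have half0 : (0 : R) < 1 / 2 by rewrite divr_gt0.
apply: (@differentiable_quadratic R d _ z l (2 * M) _ half0) => s k /andP[s0 s2] ks.
have [sz|sn0] := eqVneq s 0.
  have -> : k = 0.
    apply/rowP => i; rewrite mxE; apply/eqP; rewrite -normc_eq0 eq_le normc_ge0 andbT.
    by have := ks i; rewrite sz.
  rewrite addr0 subrr big1 ?subrr; last by move=> j _; rewrite mxE mul0r.
  by rewrite normc0 mulr_ge0 ?sqr_ge0// mulr_ge0// ltW.
have sC : s%:C != 0 by rewrite -normc_gt0 normc_real normr_gt0.
have ns : normc s%:C = s by rewrite normc_real ger0_norm.
pose h := s%:C^-1 *: k.
have h1 : polydisc 1 h.
  have := polydiscZ s%:C^-1 ks.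
  by rewrite normcV ns mulVf.
have kE : k = s%:C *: h by rewrite scalerA mulfV// scale1r.
have := lin h h1 s%:C; rewrite ns => /(_ s2); rewrite -kE mulr_sumr.
have kj j : k 0 j = s%:C * h 0 j by rewrite {1}kE mxE.
by under [X in _ - _ - X]eq_bigr => j _ do rewrite mulrA -kj.
Qed.

(** Both sides are the one number l of [mixed_along]. *)
Lemma derive_comm v h z : 'D_h ('D_v f) z = 'D_v ('D_h f) z.
Proof.
have [b b0 vb] := in_polydisc v; have [r r0 zr] := in_polydisc z.
have [c c0 hc] := in_polydisc h.
have [M M0 fM] := bounded_near r c b.
have [l [Hl Hl']] := mixed_along (fM z h v zr hc vb).
transitivity l.
  have := @cderiv_along R d ('D_v f) z h 0; rewrite scale0r addr0.
  move=> /(_ (derive_differentiable v z)) H; apply: cderiv_unique H _.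
  apply: cderiv_quadratic => s s2; rewrite add0r scale0r addr0; exact: Hl'.
have := @cderiv_along R d ('D_h f) z v 0; rewrite scale0r addr0.
move=> /(_ (derive_differentiable h z)) H; apply: cderiv_unique H.
apply: cderiv_quadratic => s s2; rewrite add0r scale0r addr0; exact: Hl.
Qed.

End DerivativesAreEntire.

(** * Linear vector fields *)

Section LinearVectorFields.
Variables (R : realType) (d : nat).
Local Notation C := R[i].
Local Notation Cd := 'rV[C]_d.
Implicit Types (A B : 'M[C]_d) (f g : Cd -> C) (z h : Cd).

(** The vector field of A sends z to the row vector z A: this is
    sum_(n,m) A_nm z_n d/dz_m. *)
Definition field_action A f z : C := 'D_(z *m A) f z.

Lemma deriveB_dir f z u v : differentiable f z ->
  'D_(u - v) f z = 'D_u f z - 'D_v f z.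
Proof. by move=> fd; rewrite !deriveE// linearB. Qed.

Lemma field_actionE A f z : differentiable f z ->
  field_action A f z = \sum_n \sum_m A n m * unit_action n m f z.
Proof.
move=> fd; rewrite /field_action derive_linear// exchange_big; apply: eq_bigr => m _.
by rewrite mxE mulr_suml; apply: eq_bigr => n _; rewrite /unit_action; ring.
Qed.

Lemma differentiable_coordM n g z :
  differentiable g z -> differentiable (fun w : Cd => w 0 n * g w) z.
Proof.
move=> gd; have := @differentiableM C Cd (fun w : Cd => w 0 n) g z.
by apply => //; exact: differentiable_coord.
Qed.

Lemma field_action_differentiable A f : (forall z, differentiable f z) ->
  forall z, differentiable (field_action A f) z.
Proof.
move=> fd z.
have -> : field_action A f =
    \sum_n \sum_m (A n m *: (fun w : Cd => w 0 n * 'D_(delta_mx 0 m) f w)).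
  apply/funext => w; rewrite field_actionE// fct_sumE; apply: eq_bigr => n _.
  by rewrite fct_sumE.
apply: differentiable_sum => n; apply: differentiable_sum => m.
apply: differentiableZ; apply: differentiable_coordM.
exact: derive_differentiable.
Qed.

(** Leibniz rule along the line z + s h, on which the coefficients of the
    vector field are affine in s. *)
Lemma derive_field_action A f h z : (forall z, differentiable f z) ->
  'D_h (field_action A f) z = 'D_(h *m A) f z + 'D_(z *m A) ('D_h f) z.
Proof.
move=> fd.
have := @cderiv_along R d (field_action A f) z h 0; rewrite scale0r addr0.
move=> /(_ (field_action_differentiable A fd z)) H; apply: cderiv_unique H _.
have prod j : cderiv
    (fun s => ((z + s *: h) *m A) 0 j * 'D_(delta_mx 0 j) f (z + s *: h)) 0
    ((h *m A) 0 j * 'D_(delta_mx 0 j) f z + (z *m A) 0 j * 'D_h ('D_(delta_mx 0 j) f) z).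
  have dj := @cderiv_along R d ('D_(delta_mx 0 j) f) z h 0.
  rewrite scale0r addr0 in dj.
  apply: cderiv_eq (cderivM (cderiv_quad ((z *m A) 0 j) ((h *m A) 0 j) 0 0)
    (dj (derive_differentiable fd _ _))) => [s|].
    congr (_ * _); 
    have -> : ((z + s *: h) *m A) 0 j = (z *m A) 0 j + s * (h *m A) 0 j.
      by rewrite mulmxDl -scalemxAl [LHS]mxE [(s *: (h *m A)) 0 j]mxE.
    by ring.
  by rewrite /= !scale0r !mulr0 mul0r !addr0.
apply: cderiv_eq (cderiv_sum (fun _ => 1) prod) => [s|].
  by rewrite /field_action derive_linear//; apply: eq_bigr => j _; rewrite mul1r.
have E1 := derive_linear (h *m A) (fd z).
have E2 := derive_linear (z *m A) (derive_differentiable fd h z).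
apply: etrans (esym (congr2 +%R E1 E2)).
rewrite -big_split; apply: eq_bigr => j _.
apply: etrans (mul1r _) (congr2 +%R erefl (congr1 ( *%R _) _)).
exact: (derive_comm fd (delta_mx 0 j) h z).
Qed.

(** By [derive_field_action] with h = z A, resp. z B, the second-order terms
    coincide up to the order of the derivatives, and cancel. *)
Lemma field_action_bracket A B f z : (forall z, differentiable f z) ->
  field_action (A *m B - B *m A) f z =
  field_action A (field_action B f) z - field_action B (field_action A f) z.
Proof.
move=> fd.
have E1 := derive_field_action B (z *m A) z fd.
have E2 := derive_field_action A (z *m B) z fd.
have E3 := derive_comm fd (z *m A) (z *m B) z.
have cancel (x y p q : C) : p = q -> x - y = (x + p) - (y + q) by move=> ->; ring.
apply: etrans (esym (congr2 (fun x y => x - y) E1 E2)).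
apply: etrans (cancel _ _ _ _ E3).
by rewrite /field_action mulmxBr !mulmxA deriveB_dir.
Qed.

Lemma polydisc_mulmx A (a r : R) z : 0 <= r -> (forall i j, normc (A i j) <= a) ->
  polydisc r z -> polydisc (d%:R * a * r) (z *m A).
Proof.
move=> r0 Aa zr j; rewrite mxE.
have : normc (\sum_i z 0 i * A i j) <= \sum_i normc (z 0 i * A i j).
  elim/big_ind2 : _ => //; first by rewrite normc0.
  by move=> x1 x2 y1 y2 h1 h2; rewrite (le_trans (le_normcD _ _))// lerD.
move=> /le_trans; apply.
rewrite (_ : d%:R * a * r = \sum_(i < d) (r * a)); last first.
  by rewrite sumr_const card_ord -mulr_natl; ring.
by apply: ler_sum => i _; rewrite normcM ler_pM ?normc_ge0.
Qed.

(** Cauchy's estimate on the disc |t| <= del of the line z + t (z A), which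
    stays in the polydisc of radius r + del * (d a r). *)
Lemma field_action_bound A f (a r del M : R) : (forall z, differentiable f z) ->
  (forall i j, normc (A i j) <= a) -> 0 <= a -> 0 <= r -> 0 < del ->
  (forall z, polydisc (r * (1 + d%:R * a * del)) z -> normc (f z) <= M) ->
  forall z, polydisc r z -> normc (field_action A f z) <= M / del.
Proof.
move=> fd Aa a0 r0 del0 fM z zr; apply: derive_bound => // t td; apply: fM.
apply: polydisc_le (polydiscD zr (polydiscZ t (polydisc_mulmx r0 Aa zr))).
rewrite mulrDr mulr1 lerD2l (_ : r * _ = del * (d%:R * a * r)); last by ring.
by rewrite ler_wpM2r// !mulr_ge0.
Qed.

End LinearVectorFields.

(** * The representation on entire functions *)

Section Representation.
Variables (R : realType) (d : nat).
Local Notation C := R[i].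
Local Notation H := (entire R d).

Lemma entire_differentiable (f : H) z : differentiable f z.
Proof. by case: f => f hf /=; exact/holomorphicP. Qed.

Lemma entire_ext (f g : H) : (forall z, f z = g z) -> f = g.
Proof. by move=> fg; apply/val_inj/funext. Qed.

Fact field_op_subproof (A : 'M[C]_d) (f : H) : field_action A f \in @holomorphic R d.
Proof.
by apply/holomorphicP; apply: field_action_differentiable; exact: entire_differentiable.
Qed.

Definition field_op (A : 'M[C]_d) (f : H) : H := Entire (field_op_subproof A f).

Lemma field_action_lin A (f g : H) c z :
  field_action A (c *: f + g : H) z = c * field_action A f z + field_action A g z.
Proof.
rewrite /field_action.
have fd := entire_differentiable f z; have gd := entire_differentiable g z.
rewrite [LHS](_ : _ = 'D_(z *m A) (c *: (f : _ -> C) + (g : _ -> C)) z)//.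
rewrite deriveD ?deriveZ//; first exact: diff_derivable.
  by apply: derivableZ; exact: diff_derivable.
exact: diff_derivable.
Qed.

Fact field_op_is_linear A : linear (field_op A).
Proof. by move=> c f g; apply: entire_ext => z; exact: field_action_lin. Qed.

HB.instance Definition _ A :=
  GRing.isLinear.Build C H H _ (field_op A) (field_op_is_linear A).

Fact field_op_continuous A : continuous (field_op A).
Proof.
move=> f U /entire_nbhsP [K [e [cK e0 sU]]].
have [r r0 Kr] := compact_sub_polydisc cK.
pose a := \sum_i \sum_j normc (A i j).
have Aa i j : normc (A i j) <= a.
  rewrite /a (bigD1 i)//= (bigD1 j)//= -addrA lerDl addr_ge0// sumr_ge0// => k _.
    exact: normc_ge0.
  by rewrite sumr_ge0// => l _; exact: normc_ge0.
have a0 : 0 <= a.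
  by rewrite sumr_ge0// => i _; rewrite sumr_ge0// => j _; exact: normc_ge0.
apply/entire_nbhsP.
exists (polydisc (r * (1 + d%:R * a * 1))), (e / 2); split.
- exact: compact_polydisc.
- by rewrite divr_gt0.
move=> g fg; apply: sU => z /Kr zr.
rewrite -[_ - _]/((field_op A f - field_op A g) z) -linearB normc_lt.
apply: (le_lt_trans (y := e / 2 / 1)); last by rewrite divr1; lra.
apply: (field_action_bound (entire_differentiable _) Aa a0 (ltW r0) ltr01) zr => w wr.
by have := fg w wr; rewrite normc_lt => /ltW.
Qed.

Definition field_endo A : cont_endo H := ContEndo (@field_op_continuous A).

Lemma representation_exists :
  exists rho : representation d H, acts_by_vector_fields rho.
Proof.
have lin (A B : 'M[C]_d) (c : C) (f : H) :
    field_op (c *: A + B) f = c *: field_op A f + field_op B f.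
  apply: entire_ext => z.
  rewrite /= [RHS](_ : _ = c * field_action A f z + field_action B f z)//.
  have fd := entire_differentiable f z.
  rewrite /field_action mulmxDr -scalemxAr !(derive_linear _ fd) mulr_sumr -big_split.
  by apply: eq_bigr => j _; rewrite !mxE mulrDl mulrA.
pose rep (X : sl R d) := field_endo (sl_mx X).
have repD X Y v : rep (X + Y) v = rep X v + rep Y v.
  by rewrite -[LHS]/(field_op (sl_mx X + sl_mx Y) v) -[sl_mx X]scale1r lin scale1r.
have repZ (t : R) X v : rep (t%:C *: X) v = t%:C *: rep X v.
  rewrite -[LHS]/(field_op (t%:C *: sl_mx X) v) -[_ *: sl_mx X]addr0 lin.
  have -> : field_op 0 v = 0.
    by apply: entire_ext => z; rewrite /= /field_action mulmx0 derive0.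
  by rewrite addr0.
have repB X Y v : rep (sl_bracket X Y) v = rep X (rep Y v) - rep Y (rep X v).
  by apply: entire_ext => z; apply: field_action_bracket; exact: entire_differentiable.
exists (Representation repD repZ repB) => A f z.
by apply: field_actionE; exact: entire_differentiable.
Qed.

End Representation.

(** * Continuous seminorms on entire functions *)

Section SeminormsOfEntireFunctions.
Variables (R : realType) (d : nat).
Local Notation C := R[i].
Local Notation H := (entire R d).

Lemma seminorm0 (q : H -> R) : continuous_seminorm q -> q 0 = 0.
Proof.
by move=> [_ qZ _]; rewrite -(scale0r (0 : H)) qZ normc0 mul0r.
Qed.

Lemma seminorm_ge0 (q : H -> R) g : continuous_seminorm q -> 0 <= q g.
Proof.
move=> cq; have [qD qZ _] := cq.
have := qD g (-1 *: g); rewrite scaleN1r subrr seminorm0// -scaleN1r qZ.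
by rewrite normcN normc1; lra.
Qed.

(** q is below 1 on a basic neighbourhood of 0, hence, by scaling, at most a
    multiple of the sup over a compact set, or over a polydisc containing it. *)
Lemma seminorm_le_sup (q : H -> R) : continuous_seminorm q ->
  exists r c : R, [/\ 0 < r, 0 < c & forall (g : H) M, 0 < M ->
    (forall z, polydisc r z -> normc (g z) <= M) -> q g <= c * M].
Proof.
move=> cq; have [qD qZ qc] := cq.
have : nbhs (0 : H) [set g | `|q 0 - q g| < 1].
  by have /(@cvgrPdist_lt _ _ _ (nbhs (0 : H))) := qc 0; apply.
move=> /entire_nbhsP [K [e [cK e0 sK]]].
have [r r0 Kr] := compact_sub_polydisc cK.
exists r, (2 / e); split=> // [|g M M0 gM]; first by rewrite divr_gt0.
have a0 : 0 < e / 2 / M by rewrite !divr_gt0.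
have : `|q 0 - q ((e / 2 / M)%:C *: g)| < 1.
  apply: sK => z /Kr /gM gz.
  rewrite -[_ - _]/(0 - (e / 2 / M)%:C * g z) sub0r normrN normc_lt.
  rewrite normcM normc_real (gtr0_norm a0).
  apply: le_lt_trans (ler_wpM2l (ltW a0) gz) _; rewrite divfK ?gt_eqF//; lra.
rewrite seminorm0// sub0r normrN qZ normc_real (gtr0_norm a0).
move=> /(le_lt_trans (ler_norm _)); rewrite -ltr_pdivlMl// => /ltW /le_trans; apply.
by rewrite le_eqVlt; apply/orP; left; apply/eqP; field; rewrite !gt_eqF.
Qed.

End SeminormsOfEntireFunctions.

(** * Estimates for words in the Lie algebra *)

Section WordEstimates.
Variables (R : realType) (d : nat).
Local Notation C := R[i].
Local Notation H := (entire R d).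
Variable rho : representation d H.
Hypothesis rhoE : acts_by_vector_fields rho.

Lemma rep_fieldE A (f : H) z : rho A f z = field_action (sl_mx A) f z.
Proof. by rewrite rhoE field_actionE//; exact: entire_differentiable. Qed.

Lemma sl_ball_entry (A : sl R d) i j : sl_ball A -> normc (sl_mx A i j) <= 1.
Proof.
move=> A1; apply: le_trans (ltW A1); rewrite /frobenius.
rewrite -[leLHS](ger0_norm (normc_ge0 _)) -sqrtr_sqr ler_wsqrtr//.
rewrite (bigD1 i)//= (bigD1 j)//= -addrA lerDl addr_ge0// sumr_ge0// => k _.
  exact: sqr_ge0.
by rewrite sumr_ge0// => l _; exact: sqr_ge0.
Qed.

(** Each letter costs a factor del^-1 and enlarges the radius by 1 + d del. *)
Lemma word_bound (xs : seq (sl R d)) (f : H) (r del M : R) :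
  (forall A, A \in xs -> sl_ball A) -> 0 <= r -> 0 < del ->
  (forall z, polydisc (r * (1 + d%:R * del) ^+ size xs) z -> normc (f z) <= M) ->
  forall z, polydisc r z -> normc (word_action rho xs f z) <= M / del ^+ size xs.
Proof.
elim: xs r => [|A xs IH] r xs1 r0 del0 fM z zr.
  by rewrite /= expr0 divr1; apply: fM; rewrite expr0 mulr1.
rewrite /= rep_fieldE exprSr invfM mulrA.
have s0 : 0 <= 1 + d%:R * del by rewrite addr_ge0// mulr_ge0// ltW.
apply: (field_action_bound (entire_differentiable _) _ ler01 r0 del0 _ zr) => [i j|].
  by apply: sl_ball_entry; apply: xs1; rewrite mem_head.
rewrite mulr1 => w; apply: IH => //.
  by move=> B Bxs; apply: xs1; rewrite in_cons Bxs orbT.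
  by rewrite mulr_ge0.
by move=> u; rewrite -mulrA -exprS; exact: fM.
Qed.

(** n^n / n! is one term of the exponential series of n. *)
Lemma expn_le_fact (n : nat) : (n%:R : R) ^+ n <= n`!%:R * expR 1 ^+ n.
Proof.
case: n => [|n]; first by rewrite fact0 !expr0 mulr1.
have := @expR_ge1Dxn R n.+1%:R n (ler0n _ _).
rewrite -{2}[n.+1%:R]mulr1 expRM_natl => h.
have F0 : (0 : R) < n.+1`!%:R by rewrite ltr0n fact_gt0.
rewrite mulrC -ler_pdivrMr//; lra.
Qed.

(** [word_bound] with del = s / n: the step is adapted to the length of the
    word so that the total dilation of the radius is at most e^(d s). *)
Lemma word_bound_fact (xs : seq (sl R d)) (f : H) (r s M : R) :
  (forall A, A \in xs -> sl_ball A) -> 0 <= r -> 0 < s -> 0 <= M ->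
  (forall z, polydisc (r * expR (d%:R * s)) z -> normc (f z) <= M) ->
  forall z, polydisc r z ->
    normc (word_action rho xs f z) <= (size xs)`!%:R * (expR 1 / s) ^+ size xs * M.
Proof.
move=> xs1 r0 s0 M0 fM z zr; set n := size xs.
have [n0|n0] := posnP n.
  have -> : xs = [::] by apply: size0nil.
  rewrite n0 fact0 expr0 !mul1r /=; apply: fM; apply: polydisc_le zr.
  by rewrite ler_peMr// -expR0 ler_expR mulr_ge0// ltW.
have nR : (0 : R) < n%:R by rewrite ltr0n.
have := @word_bound xs f r (s / n%:R) M xs1 r0 (divr_gt0 s0 nR) _ z zr.
rewrite -/n => H1; apply: le_trans (H1 _) _.
  move=> w wr; apply: fM; apply: polydisc_le wr; rewrite ler_wpM2l//.
  apply: le_trans (lerXn2r n _ _ (expR_ge1Dx _)) _.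
  - by rewrite nnegrE addr_ge0// mulr_ge0// divr_ge0// ltW.
  - by rewrite nnegrE expR_ge0.
  by rewrite -expRM_natl ler_expR (_ : _ * _ = d%:R * s)//; field; rewrite gt_eqF.
rewrite !expr_div_n invf_div mulrC ler_wpM2r// mulrA ler_wpM2r ?expn_le_fact//.
by rewrite invr_ge0 exprn_ge0// ltW.
Qed.

Lemma geometric_half_le N : \sum_(0 <= n < N) (1 / 2 : R) ^+ n <= 2.
Proof.
suff -> : \sum_(0 <= n < N) (1 / 2 : R) ^+ n = 2 - 2 * (1 / 2) ^+ N.
  by rewrite lerBlDr lerDl mulr_ge0// exprn_ge0// divr_ge0.
elim: N => [|N IH]; first by rewrite big_geq// expr0; ring.
by rewrite big_nat_recr//= IH exprS; field.
Qed.

Lemma sup_words_ge0 (q : H -> R) g n : continuous_seminorm q ->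
  (0 <= ereal_sup [set (q (word_action rho xs g))%:E | xs in
      [set xs : n.-tuple (sl R d) | forall i, sl_ball (tnth xs i)]])%E.
Proof.
move=> cq; pose xs : n.-tuple (sl R d) := [tuple 0 | i < n].
apply: (@le_trans _ _ (q (word_action rho xs g))%:E).
  by rewrite lee_fin seminorm_ge0.
apply: ereal_sup_ubound; exists xs => // i; rewrite tnth_mktuple /sl_ball /= /frobenius.
rewrite big1 ?sqrtr0// => j _; rewrite big1// => k _.
by rewrite mxE normc0 expr0n.
Qed.

Lemma weight_ge0 (s : R) n : 0 <= s -> 0 <= n`!%:R `^ (0 - 1) * s ^+ n :> R.
Proof. by move=> s0; rewrite mulr_ge0 ?powR_ge0 ?exprn_ge0. Qed.

Lemma entire_seminorm_bound (q : H -> R) (s : R) : continuous_seminorm q -> 0 <= s ->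
  exists r c : R, [/\ 0 < r, 0 < c & forall (g : H) M, 0 < M ->
    (forall z, polydisc r z -> normc (g z) <= M) ->
    (entire_seminorm rho 0 s q g <= (c * M)%:E)%E].
Proof.
move=> cq s0; have [r [c [r0 c0 qM]]] := seminorm_le_sup cq.
have e0 : 0 < expR 1 :> R by exact: expR_gt0.
(* This t makes the ratio s * (e / t) of the dominating geometric series at
   most 1 / 2. *)
pose t := 2 * expR 1 * (s + 1).
have t0 : 0 < t by rewrite mulr_gt0 ?mulr_gt0// ltr_wpDl.
exists (r * expR (d%:R * t)), (2 * c); split; rewrite ?mulr_gt0 ?expR_gt0// => g M M0 gM.
have term n : ((n`!%:R `^ (0 - 1) * s ^+ n)%:E *
    ereal_sup [set (q (word_action rho xs g))%:E | xs in
      [set xs : n.-tuple (sl R d) | forall i, sl_ball (tnth xs i)]]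
    <= (c * M * (1 / 2) ^+ n)%:E)%E.
  have F0 : (0 : R) < n`!%:R by rewrite ltr0n fact_gt0.
  have X0 : 0 < n`!%:R * (expR 1 / t) ^+ n * M by rewrite !mulr_gt0// exprn_gt0// divr_gt0.
  apply: (@le_trans _ _ ((n`!%:R `^ (0 - 1) * s ^+ n)%:E
      * (c * (n`!%:R * (expR 1 / t) ^+ n * M))%:E)%E).
    apply: lee_wpmul2l; first by rewrite lee_fin weight_ge0.
    apply: ge_ereal_sup => _ [xs xs1 <-]; rewrite lee_fin; apply: qM => // z zr.
    have := @word_bound_fact xs g r t M _ (ltW r0) t0 (ltW M0) gM z zr.
    rewrite size_tuple; apply => A.
    by move=> /tnthP[i ->].
  rewrite -EFinM lee_fin sub0r (powR_inv1 (ltW F0)).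
  have -> : n`!%:R^-1 * s ^+ n * (c * (n`!%:R * (expR 1 / t) ^+ n * M)) =
      c * M * (s * (expR 1 / t)) ^+ n.
    rewrite [X in _ = _ * X]exprMn; move: (_ ^+ n) (_ ^+ n) => X Y.
    by field; rewrite gt_eqF.
  apply: ler_wpM2l; first by rewrite mulr_ge0 ?(ltW c0) ?(ltW M0).
  apply: lerXn2r.
  - by rewrite nnegrE mulr_ge0 ?divr_ge0// ltW.
  - by rewrite nnegrE divr_ge0.
  have s1 : s + 1 != 0 by rewrite gt_eqF// ltr_wpDl.
  rewrite /t (_ : s * _ = s / (s + 1) / 2); last by field; rewrite s1 gt_eqF.
  by rewrite ler_wpM2r// ler_pdivrMr ?ltr_wpDl// mul1r lerDl.
rewrite /entire_seminorm; apply: lime_le.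
  apply: is_cvg_nneseries => n _ _; apply: mule_ge0; last exact: sup_words_ge0.
  by rewrite lee_fin weight_ge0.
apply: nearW => N; apply: (le_trans (lee_sum _ (fun n _ => term n))).
have -> : 2 * c * M = c * M * 2 by ring.
rewrite sumEFin lee_fin -mulr_sumr; apply: ler_wpM2l; last exact: geometric_half_le.
by rewrite mulr_ge0 ?(ltW c0) ?(ltW M0).
Qed.

End WordEstimates.

(** * Sup norms over polydiscs *)

Section SupSeminorm.
Variables (R : realType) (d : nat) (r : R).
Hypothesis r0 : 0 <= r.
Local Notation C := R[i].
Local Notation H := (entire R d).

Definition sup_seminorm (f : H) : R := sup [set normc (f z) | z in polydisc r].

Lemma le_sup_seminorm (f : H) z : polydisc r z -> normc (f z) <= sup_seminorm f.
Proof.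
move=> zr; apply: ub_le_sup; last by exists z.
have [M _ fM] := bounded_on_compact (differentiable_cont (entire_differentiable f))
  (@compact_polydisc R d r).
by exists M => _ [w wr <-]; exact: fM.
Qed.

Lemma sup_seminorm_le (f : H) M :
  (forall z, polydisc r z -> normc (f z) <= M) -> sup_seminorm f <= M.
Proof.
move=> fM; apply: ge_sup; last by move=> _ [z zr <-]; exact: fM.
by exists (normc (f 0)), 0 => // i; rewrite mxE normc0.
Qed.

Lemma sup_seminormD (f g : H) : sup_seminorm (f + g) <= sup_seminorm f + sup_seminorm g.
Proof.
apply: sup_seminorm_le => z zr; rewrite -[(f + g) z]/(f z + g z).
by rewrite (le_trans (le_normcD _ _))// lerD// le_sup_seminorm.
Qed.

Lemma sup_seminormZ (a : C) (f : H) : sup_seminorm (a *: f) = normc a * sup_seminorm f.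
Proof.
have le (b : C) (g : H) : sup_seminorm (b *: g) <= normc b * sup_seminorm g.
  apply: sup_seminorm_le => z zr; rewrite -[(b *: g) z]/(b * g z).
  by rewrite normcM ler_wpM2l ?normc_ge0 ?le_sup_seminorm.
apply/eqP; rewrite eq_le le /=; have [->|a0] := eqVneq a 0.
  rewrite normc0 mul0r.
  apply: le_trans (le_sup_seminorm (0 *: f) (_ : polydisc r 0)); first exact: normc_ge0.
  by move=> i; rewrite mxE normc0.
have := le a^-1 (a *: f); rewrite scalerA mulVf// scale1r normcV.
by rewrite ler_pdivlMl ?normc_gt0.
Qed.

Lemma sup_seminorm_continuous : continuous_seminorm sup_seminorm.
Proof.
split; [exact: sup_seminormD|exact: sup_seminormZ|move=> f].
apply/(@cvgrPdist_le _ _ _ (nbhs f)) => e e0.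
apply/entire_nbhsP; exists (polydisc r), e; split=> [||g fg] //.
  exact: compact_polydisc.
have fgS : sup_seminorm (f - g) <= e.
  by apply: sup_seminorm_le => z /fg; rewrite normc_lt => /ltW.
have h1 := sup_seminormD (f - g) g; have h2 := sup_seminormD (g - f) f.
have h3 : sup_seminorm (g - f) = sup_seminorm (f - g).
  by rewrite -opprB -scaleN1r sup_seminormZ normcN normc1 mul1r.
move: h1 h2; rewrite h3 !subrK => h1 h2 /=.
by rewrite ler_norml; apply/andP; split; lra.
Qed.

End SupSeminorm.

(** * Comparison of the topologies *)

Section Topologies.
Variables (R : realType) (d : nat).
Local Notation H := (entire R d).
Variable rho : representation d H.
Hypothesis rhoE : acts_by_vector_fields rho.

Lemma entire_vectors_all : entire_vectors rho 0 = [set: H].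
Proof.
rewrite -subTset => f _ q s cq s0.
have [r [c [_ _ qM]]] := entire_seminorm_bound rhoE cq s0.
have [M M0 fM] := bounded_on_compact (differentiable_cont (entire_differentiable f))
  (@compact_polydisc R d r).
by apply: le_lt_trans (qM f M M0 fM) _; rewrite ltry.
Qed.

(** At radius 0 only the term n = 0 survives, with 0^0 = 1, and the only word of
    length 0 is empty. *)
Lemma le_entire_seminorm (q : H -> R) f : continuous_seminorm q ->
  ((q f)%:E <= entire_seminorm rho 0 0 q f)%E.
Proof.
move=> cq; rewrite /entire_seminorm.
pose u n := ((n`!%:R `^ (0 - 1) * (0 : R) ^+ n)%:E *
    ereal_sup [set (q (word_action rho xs f))%:E | xs in
      [set xs : n.-tuple (sl R d) | forall i, sl_ball (tnth xs i)]])%E.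
have u0 n : (0 <= u n)%E.
  apply: mule_ge0; last exact: sup_words_ge0.
  by rewrite lee_fin weight_ge0.
apply: le_trans (_ : \sum_(0 <= n < 1) u n <= _)%E; last first.
  by apply: nneseries_lim_ge => n _ _.
rewrite big_nat1 /u fact0 powR1 expr0 mulr1 mul1e.
apply: ereal_sup_ubound; exists [tuple] => //.
by case.
Qed.

(** Finitely many seminorms are dominated by one sup norm, over the polydisc
    whose radius is the sum of theirs. *)
Lemma entire_open_open (U : set H) : entire_open rho 0 U -> open U.
Proof.
move=> [_ HU]; rewrite openE => v Uv; apply/entire_nbhsP.
have [k [s [q [e [s0 cq e0 sU]]]]] := HU v Uv.
have [rs Hrs] := choice (fun i => entire_seminorm_bound rhoE (cq i) (s0 i)).
have [cs Hrc] := choice Hrs.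
pose r := \sum_i rs i; pose c := 1 + \sum_i cs i.
have rp i : 0 <= rs i by have [/ltW] := Hrc i.
have cp i : 0 <= cs i by have [_ /ltW] := Hrc i.
have c0 : 0 < c by rewrite ltr_wpDr// sumr_ge0.
have M0 : 0 < e / 2 / c by rewrite !divr_gt0.
exists (polydisc r), (e / 2 / c); split=> [||w vw]; first exact: compact_polydisc.
  exact: M0.
apply: sU => [|i]; first by rewrite entire_vectors_all.
have [_ _ bound] := Hrc i.
apply: (@le_lt_trans _ _ (cs i * (e / 2 / c))%:E).
  apply: bound => // z zr; rewrite -[(w - v) z]/(w z - v z) normcB.
  have zr' : polydisc r z.
    by apply: polydisc_le zr; rewrite /r (bigD1 i)//= lerDl sumr_ge0.
  by have := vw z zr'; rewrite normc_lt => /ltW.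
rewrite lte_fin; apply: (@le_lt_trans _ _ (e / 2)); last by lra.
rewrite mulrCA -[leRHS]mulr1 ler_wpM2l ?divr_ge0 ?(ltW e0)//.
rewrite ler_pdivrMr// mul1r /c (bigD1 i)//= addrCA lerDl addr_ge0// sumr_ge0//.
Qed.

(** The single seminorm of radius 0 associated with a sup norm suffices. *)
Lemma open_entire_open (U : set H) : open U -> entire_open rho 0 U.
Proof.
move=> oU; split; first by rewrite entire_vectors_all.
move=> v Uv; have /entire_nbhsP [K [e [cK e0 sU]]] : nbhs v U by exact: open_nbhs_nbhs.
have [r r0 Kr] := compact_sub_polydisc cK.
have cS := sup_seminorm_continuous d (ltW r0).
exists 1%N, (fun _ => 0), (fun _ => sup_seminorm r), e; split=> // w _ /(_ ord0) wv.
apply: sU => z /Kr zr; rewrite normc_lt normcB -[_ - _]/((w - v) z).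
rewrite -lte_fin; apply: le_lt_trans wv; apply: le_trans (le_entire_seminorm (w - v) cS).
by rewrite lee_fin le_sup_seminorm.
Qed.

End Topologies.

Theorem proposition4p6 (R : realType) (d : nat) :
  (exists rho : representation d (entire R d), acts_by_vector_fields rho) /\
  forall rho : representation d (entire R d), acts_by_vector_fields rho ->
    entire_vectors rho 0 = [set: entire R d] /\
    (forall U : set (entire R d), entire_open rho 0 U <-> open U).
Proof.
split; first exact: representation_exists.
move=> rho rhoE; split; first exact: entire_vectors_all.
by move=> U; split; [exact: entire_open_open|exact: open_entire_open].
Qed.
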